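(* For integers $m\ge 2$ and $n\ge 1$, let $G_{n,m}$ be a random variable whose probability generating function is $\mathbb{E}\,q^{G_{n,m}} = m^{-n} G_n^{(m)}(q)$. Let $(m_j,n_j)_{j\ge1}$ be any sequence of pairs of integers with $m_j\ge2$, $m_j\to\infty$ and $n_j\to\infty$. Then, along this sequence, \[ \frac{G_{n_j,m_j}-\mathbb{E}G_{n_j,m_j}}{(\operatorname{Var}G_{n_j,m_j})^{1/2}}\xrightarrow{d} N(0,1); \] equivalently, \[ \frac{G_{n_j,m_j}-\mathbb{E}G_{n_j,m_j}}{n_j^{3/2}}\xrightarrow{d} N\Bigl(0,\tfrac{1}{36}\Bigr). \]
   Context: For $\ell\ge1$, $[\ell]_q=(1-q^\ell)/(1-q)$, $[k]!_q=[1]_q[2]_q\cdots[k]_q$ (with $[0]!_q=1$), and for nonnegative integers $k_1+\dots+k_m=n$ the $q$-multinomial coefficient is $\binom{n}{k_1,\dots,k_m}_q=\frac{[n]!_q}{[k_1]!_q\cdots[k_m]!_q}$. The generalized Galois number is the polynomial $G_n^{(m)}(q)=\sum_{k_1+\dots+k_m=n}\binom{n}{k_1,\dots,k_m}_q$ (sum over nonnegative integers), which has nonnegative coefficients and satisfies $G_n^{(m)}(1)=m^n$. $\xrightarrow{d}$ denotes convergence in distribution and $N(\mu,\sigma^2)$ the normal distribution. *)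

(* Defs.v *)
From HB Require Import structures.
From mathcomp Require Import all_boot all_order all_algebra.
From mathcomp Require Import all_classical all_reals all_analysis.
From mathcomp Require Import measurable_realfun.

Set Implicit Arguments.
Unset Strict Implicit.
Unset Printing Implicit Defensive.

Import Order.TTheory GRing.Theory Num.Theory.
Import numFieldNormedType.Exports.

Local Open Scope classical_set_scope.
Local Open Scope ring_scope.

(* All the divisions of polynomials below are exact: see qintK and
   qmultinomialK. *)
Section q_analogues.
Variable K : fieldType.

Definition qint (l : nat) : {poly K} := (1 - 'X^l) %/ (1 - 'X).

Definition qfact (k : nat) : {poly K} := \prod_(1 <= l < k.+1) qint l.

Definition qmultinomial (n m : nat) (k : 'I_m -> nat) : {poly K} :=
  qfact n %/ \prod_(i < m) qfact (k i).

(* The parts of a composition of n are at most n, so the index type below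
   contains all the m-tuples of natural numbers with sum n. *)
Definition galois (m n : nat) : {poly K} :=
  \sum_(k : {ffun 'I_m -> 'I_n.+1} | (\sum_(i < m) k i)%N == n)
     qmultinomial n (fun i => k i : nat).

Lemma oneBX_neq0 : (1 - 'X : {poly K}) != 0.
Proof. by rewrite -opprB oppr_eq0 polyXsubC_eq0. Qed.

Lemma qintK l : qint l * (1 - 'X) = 1 - 'X^l.
Proof.
rewrite /qint divpK //; apply/dvdpP; exists (\sum_(i < l) 'X^i).
by rewrite -[in LHS](expr1n _ l) subrXX mulrC; congr (_ * _);
  apply: eq_bigr => i _; rewrite expr1n mul1r.
Qed.

Lemma qintE l : qint l = \sum_(i < l) 'X^i.
Proof.
apply: (mulIf oneBX_neq0); rewrite qintK -[in LHS](expr1n _ l) subrXX mulrC.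
by congr (_ * _); apply: eq_bigr => i _; rewrite expr1n mul1r.
Qed.

Lemma qintD a b : qint (a + b) = qint a + 'X^a * qint b.
Proof.
apply: (mulIf oneBX_neq0); rewrite mulrDl -mulrA !qintK exprD.
by rewrite mulrBr mulr1 addrA subrK.
Qed.

Lemma qfactS n : qfact n.+1 = qfact n * qint n.+1.
Proof. by rewrite /qfact big_nat_recr. Qed.

Lemma qfact0 : qfact 0 = 1.
Proof. by rewrite /qfact big_nil. Qed.

Lemma qint_neq0 l : (0 < l)%N -> qint l != 0.
Proof.
case: l => // l _; apply/eqP => /(congr1 (fun p => p * (1 - 'X))).
rewrite qintK mul0r => /(congr1 (fun p : {poly K} => p`_0)).
by rewrite coefB coef1 coefXn coef0 /= subr0 => /eqP; rewrite oner_eq0.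
Qed.

Lemma qfact_neq0 n : qfact n != 0.
Proof.
elim: n => [|n IH]; first by rewrite qfact0 oner_eq0.
by rewrite qfactS mulf_neq0 // qint_neq0.
Qed.

Lemma qfact_dvd a b : qfact a * qfact b %| qfact (a + b).
Proof.
have [n] := ubnP (a + b); elim: n a b => // n IH [|a] [|b] ab.
- by rewrite qfact0 mul1r.
- by rewrite qfact0 mul1r.
- by rewrite qfact0 mulr1 addn0.
have -> : qfact (a.+1 + b.+1) =
    qfact (a + b.+1) * qint a.+1 + qfact (a.+1 + b) * 'X^(a.+1) * qint b.+1.
  have -> : (a + b.+1 = a.+1 + b)%N by rewrite addSnnS.
  by rewrite -mulrA -mulrDr -qintD [in LHS]addnS qfactS addnS.
apply: dvdp_add.
- rewrite qfactS mulrAC dvdp_mul2r ?qint_neq0 //.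
  by apply: IH; rewrite addSn in ab.
- rewrite (qfactS b) mulrA dvdp_mul2r ?qint_neq0 // dvdp_mulr //.
  by apply: IH; rewrite addnS in ab.
Qed.

Lemma prod_qfact_dvd (I : Type) (r : seq I) (k : I -> nat) :
  \prod_(i <- r) qfact (k i) %| qfact (\sum_(i <- r) k i)%N.
Proof.
elim: r => [|i r IH]; first by rewrite !big_nil qfact0.
rewrite !big_cons; apply: dvdp_trans (qfact_dvd _ _).
by rewrite dvdp_mul2l ?qfact_neq0.
Qed.

Lemma qmultinomialK (n m : nat) (k : 'I_m -> nat) :
  (\sum_(i < m) k i)%N = n ->
  qmultinomial n k * \prod_(i < m) qfact (k i) = qfact n.
Proof. by move=> <-; rewrite divpK // prod_qfact_dvd. Qed.

End q_analogues.

Section random_variables.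
Context d (T : measurableType d) (R : realType) (P : probability T R).

Definition has_pgf (X : {RV P >-> nat}) (g : {poly R}) : Prop :=
  forall q : R, `|q| <= 1 -> 'E_P[fun t => (q ^+ X t)%R]%E = (g.[q])%:E.

Definition natRV (X : {RV P >-> nat}) : T -> R := fun t => (X t)%:R.

Lemma measurable_natRV (X : {RV P >-> nat}) : measurable_fun setT (natRV X).
Proof.
have mnat : measurable_fun setT (fun n : nat => n%:R : R) by [].
exact: measurableT_comp mnat (measurable_funPT X).
Qed.

HB.instance Definition _ (X : {RV P >-> nat}) :=
  isMeasurableFun.Build _ _ _ _ (natRV X) (measurable_natRV X).

Definition center_scale (X : {RV P >-> R}) (s : R) : T -> R :=
  fun t => (X t - fine 'E_P[X]%E) / s.

Lemma measurable_center_scale (X : {RV P >-> R}) (s : R) :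
  measurable_fun setT (center_scale X s).
Proof.
by apply: measurable_funM => //; exact: measurable_funB.
Qed.

HB.instance Definition _ (X : {RV P >-> R}) (s : R) :=
  isMeasurableFun.Build _ _ _ _ (center_scale X s)
    (measurable_center_scale X s).

End random_variables.

Arguments has_pgf {d T R} P X g.
Arguments natRV {d T R} P X.
Arguments center_scale {d T R} P X s.

(* Pointwise convergence of the distribution functions at the continuity
   points of the limit; the variables need not share a probability space. *)
Definition cvg_in_distribution (R : realType) (d : nat -> measure_display)
    (T : forall j, measurableType (d j)) (P : forall j, probability (T j) R)
    (X : forall j, {RV (P j) >-> R})
    (mu : probability (measurableTypeR R) R) : Prop :=
  forall x : R, {for x, continuous (fun y : R => mu `]-oo, y]%classic)} ->
    cdf (X j) x @[j --> \oo] --> mu `]-oo, x]%classic.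

Arguments cvg_in_distribution {R d T} P X mu.

(* Main.v *)
(* A q-multinomial coefficient times the q-factorials of its parts is [n]!_q.
   Hence, if k is the vector of letter counts of a uniform random word of length
   n over m letters and, given k, G and Y are independent with generating
   functions proportional to the q-multinomial coefficient and to the product of
   the [k_i]!_q, then G is distributed as G_{n,m} and G + Y as the number of
   inversions of a uniform permutation of size n.  The variance of Y is
   O(n ^ 3 / m), so Y is negligible at the scale n ^ (3/2) as soon as m tends to
   infinity, and the theorem reduces to the central limit theorem for inversions,
   i.e. for the sum of independent uniform variables on {0, ..., l - 1}, l <= n.
   That one is obtained by Trotter's operator version of the Lindeberg method,
   with cubic splines as test functions. *)

Require Import Defs.
From HB Require Import structures.
From mathcomp Require Import all_boot all_order all_algebra.
From mathcomp Require Import all_classical all_reals all_analysis.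
From mathcomp Require Import measurable_realfun.
From mathcomp Require Import ring lra.

Set Implicit Arguments.
Unset Strict Implicit.
Unset Printing Implicit Defensive.

Import Order.TTheory GRing.Theory Num.Theory.
Import numFieldNormedType.Exports.

Local Open Scope classical_set_scope.
Local Open Scope ring_scope.

(** * Finite expectations and the Mahonian law *)

Section finite_expectation.
Variable R : realFieldType.
Implicit Types (p q : {poly R}) (f g : nat -> R).

Definition pexp p f : R := \sum_(i < size p) p`_i * f i.

Lemma pexp_wide N p f : (size p <= N)%N -> pexp p f = \sum_(i < N) p`_i * f i.
Proof.
move=> pN; rewrite /pexp -(subnK pN) addnC big_split_ord /=.
rewrite [X in _ + X]big1 ?addr0 // => i _.
by rewrite nth_default ?mul0r // leq_addr.
Qed.

Lemma eq_pexp p f g : f =1 g -> pexp p f = pexp p g.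
Proof. by move=> fg; apply: eq_bigr => i _; rewrite fg. Qed.

Lemma pexpDf p f g : pexp p (fun i => f i + g i) = pexp p f + pexp p g.
Proof. by rewrite -big_split; apply: eq_bigr => i _; rewrite mulrDr. Qed.

Lemma pexpZf p c f : pexp p (fun i => c * f i) = c * pexp p f.
Proof. by rewrite [RHS]mulr_sumr; apply: eq_bigr => i _; rewrite mulrCA. Qed.

Lemma pexp_cst p c : pexp p (fun=> c) = p.[1] * c.
Proof.
rewrite /pexp -mulr_suml; congr (_ * _); rewrite horner_coef.
by apply: eq_bigr => i _; rewrite expr1n mulr1.
Qed.

Lemma pexp0 f : pexp 0 f = 0.
Proof. by rewrite /pexp size_poly0 big_ord0. Qed.

Lemma pexpD p q f : pexp (p + q) f = pexp p f + pexp q f.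
Proof.
rewrite (pexp_wide f (size_polyD p q)).
rewrite (pexp_wide f (leq_maxl (size p) (size q))).
rewrite (pexp_wide f (leq_maxr (size p) (size q))) -big_split.
by apply: eq_bigr => i _; rewrite coefD mulrDl.
Qed.

Lemma pexpZ c p f : pexp (c *: p) f = c * pexp p f.
Proof.
rewrite (pexp_wide f (size_scale_leq c p)) [RHS]mulr_sumr.
by apply: eq_bigr => i _; rewrite coefZ mulrA.
Qed.

Lemma pexp_sum I (r : seq I) (P : pred I) (F : I -> {poly R}) f :
  pexp (\sum_(i <- r | P i) F i) f = \sum_(i <- r | P i) pexp (F i) f.
Proof. exact: (big_morph (fun p => pexp p f) (fun p q => pexpD p q f) (pexp0 f)). Qed.

Lemma pexpXn n f : pexp 'X^n f = f n.
Proof.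
rewrite /pexp size_polyXn big_ord_recr /= coefXn eqxx mul1r big1 ?add0r // => i _.
by rewrite coefXn ltn_eqF ?mul0r.
Qed.

Lemma pexpM p q f : pexp (p * q) f = pexp p (fun i => pexp q (fun j => f (i + j)%N)).
Proof.
rewrite -[p in LHS]coefK poly_def mulr_suml pexp_sum; apply: eq_bigr => i _.
rewrite -scalerAl pexpZ; congr (_ * _).
rewrite -[q in LHS]coefK poly_def mulr_sumr pexp_sum; apply: eq_bigr => j _.
by rewrite -scalerAr pexpZ -exprD pexpXn.
Qed.

Definition mean p := pexp p (fun i => i%:R).
Definition var p := pexp p (fun i => (i%:R - mean p) ^+ 2).

Lemma pexp_center p : p.[1] = 1 -> pexp p (fun i => i%:R - mean p) = 0.
Proof. by move=> p1; rewrite pexpDf pexp_cst p1 mul1r subrr. Qed.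

Lemma pexp_sqr_dist p c : p.[1] = 1 ->
  pexp p (fun i => (i%:R - c) ^+ 2) = var p + (mean p - c) ^+ 2.
Proof.
move=> p1.
transitivity (pexp p (fun i => (i%:R - mean p) ^+ 2 +
   ((2 * (mean p - c)) * (i%:R - mean p) + (mean p - c) ^+ 2))).
  by apply: eq_pexp => i; ring.
by rewrite pexpDf pexpDf pexpZf pexp_center // mulr0 add0r pexp_cst p1 mul1r.
Qed.

Lemma mean_mul p q : p.[1] = 1 -> q.[1] = 1 -> mean (p * q) = mean p + mean q.
Proof.
move=> p1 q1; rewrite /mean pexpM.
transitivity (pexp p (fun i => i%:R + mean q)).
  apply: eq_pexp => i; under eq_pexp do rewrite natrD.
  by rewrite pexpDf pexp_cst q1 mul1r.
by rewrite pexpDf pexp_cst p1 mul1r.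
Qed.

Lemma var_mul p q : p.[1] = 1 -> q.[1] = 1 -> var (p * q) = var p + var q.
Proof.
move=> p1 q1; rewrite {1}/var pexpM.
transitivity (pexp p (fun i => (i%:R - mean p) ^+ 2 + var q)).
  apply: eq_pexp => i.
  transitivity (pexp q (fun j => (i%:R - mean p) ^+ 2 +
     ((2 * (i%:R - mean p)) * (j%:R - mean q) + (j%:R - mean q) ^+ 2))).
    by apply: eq_pexp => j; rewrite mean_mul // natrD; ring.
  by rewrite pexpDf pexpDf (pexpZf _ (2 * _)) pexp_center // mulr0 add0r pexp_cst q1 mul1r.
by rewrite pexpDf pexp_cst p1 mul1r.
Qed.

Lemma mean1 : mean 1 = 0.
Proof. by rewrite /mean -(expr0 'X) pexpXn. Qed.

Lemma var1 : var 1 = 0.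
Proof. by rewrite /var mean1 -(expr0 'X) pexpXn subrr expr0n. Qed.

Lemma horner_prod1 I (r : seq I) (F : I -> {poly R}) :
  (forall i, (F i).[1] = 1) -> (\prod_(i <- r) F i).[1] = 1.
Proof. by move=> F1; rewrite horner_prod big1. Qed.

Lemma mean_prod I (r : seq I) (F : I -> {poly R}) : (forall i, (F i).[1] = 1) ->
  mean (\prod_(i <- r) F i) = \sum_(i <- r) mean (F i).
Proof.
move=> F1; elim: r => [|i r IH]; first by rewrite !big_nil mean1.
by rewrite !big_cons mean_mul ?horner_prod1 // IH.
Qed.

Lemma var_prod I (r : seq I) (F : I -> {poly R}) : (forall i, (F i).[1] = 1) ->
  var (\prod_(i <- r) F i) = \sum_(i <- r) var (F i).
Proof.
move=> F1; elim: r => [|i r IH]; first by rewrite !big_nil var1.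
by rewrite !big_cons var_mul ?horner_prod1 // IH.
Qed.

Definition nneg_coefs p := forall i, 0 <= p`_i.

Lemma nneg_coefs1 : nneg_coefs 1.
Proof. by move=> i; rewrite coef1. Qed.

Lemma nneg_coefsXn n : nneg_coefs 'X^n.
Proof. by move=> i; rewrite coefXn. Qed.

Lemma nneg_coefsD p q : nneg_coefs p -> nneg_coefs q -> nneg_coefs (p + q).
Proof. by move=> p0 q0 i; rewrite coefD addr_ge0. Qed.

Lemma nneg_coefsZ c p : 0 <= c -> nneg_coefs p -> nneg_coefs (c *: p).
Proof. by move=> c0 p0 i; rewrite coefZ mulr_ge0. Qed.

Lemma nneg_coefsM p q : nneg_coefs p -> nneg_coefs q -> nneg_coefs (p * q).
Proof.
by move=> p0 q0 i; rewrite coefM; apply: sumr_ge0 => j _; rewrite mulr_ge0.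
Qed.

Lemma ler_pexp p f g : nneg_coefs p -> (forall i, f i <= g i) ->
  pexp p f <= pexp p g.
Proof.
by move=> p0 fg; apply: ler_sum => i _; rewrite ler_wpM2l .
Qed.

Lemma pexp_ge0 p f : nneg_coefs p -> (forall i, 0 <= f i) -> 0 <= pexp p f.
Proof. by move=> p0 f0; apply: sumr_ge0 => i _; rewrite mulr_ge0 . Qed.

Lemma var_ge0 p : nneg_coefs p -> 0 <= var p.
Proof. by move=> p0; apply: pexp_ge0 => // i; exact: sqr_ge0. Qed.

Lemma ler_norm_pexp p f : nneg_coefs p ->
  `|pexp p f| <= pexp p (fun i => `|f i|).
Proof.
move=> p0; apply: le_trans (ler_norm_sum _ _ _) _; apply: ler_sum => i _.
by rewrite normrM ger0_norm .
Qed.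

End finite_expectation.

Section mahonian.
Variable R : realFieldType.

Definition unif (l : nat) : {poly R} := l%:R^-1 *: qint R l.

Definition mahonian (n : nat) : {poly R} := \prod_(l < n) unif l.+1.

Lemma sum_natr n : \sum_(i < n) i%:R = (n%:R * (n%:R - 1)) / 2 :> R.
Proof.
elim: n => [|n IH]; first by rewrite big_ord0 !mul0r.
by rewrite big_ord_recr /= IH -natr1; field.
Qed.

Lemma sum_natr_sqr n :
  \sum_(i < n) i%:R ^+ 2 = n%:R * (n%:R - 1) * (2 * n%:R - 1) / 6 :> R.
Proof.
elim: n => [|n IH]; first by rewrite big_ord0 !mul0r.
by rewrite big_ord_recr /= IH -natr1; field.
Qed.

Lemma pexp_unif l f : pexp (unif l) f = l%:R^-1 * \sum_(i < l) f i.
Proof.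
rewrite /unif pexpZ qintE pexp_sum; congr (_ * _).
by apply: eq_bigr => i _; rewrite pexpXn.
Qed.

Lemma unif_nneg l : nneg_coefs (unif l).
Proof.
rewrite /unif qintE; apply: nneg_coefsZ; first by rewrite invr_ge0.
by move=> i; rewrite coef_sum; apply: sumr_ge0 => j _; exact: nneg_coefsXn.
Qed.

Lemma unif1 l : (0 < l)%N -> (unif l).[1] = 1.
Proof.
move=> l0; have := pexp_cst (unif l) 1; rewrite mulr1 => <-.
rewrite pexp_unif sumr_const card_ord mulVf // pnatr_eq0 -lt0n //.
Qed.

Lemma mean_unif l : (0 < l)%N -> mean (unif l) = (l%:R - 1) / 2.
Proof.
move=> l0; rewrite /mean pexp_unif sum_natr; field.
by rewrite pnatr_eq0 -lt0n.
Qed.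

Lemma var_unif l : (0 < l)%N -> var (unif l) = (l%:R ^+ 2 - 1) / 12.
Proof.
move=> l0; have := pexp_sqr_dist 0 (unif1 l0); rewrite pexp_unif.
under eq_bigr do rewrite subr0.
rewrite sum_natr_sqr mean_unif // subr0 => e.
have {e} -> : var (unif l) = l%:R^-1 * (l%:R * (l%:R - 1) * (2 * l%:R - 1) / 6)
   - ((l%:R - 1) / 2) ^+ 2 by rewrite e addrK.
by field; rewrite pnatr_eq0 -lt0n.
Qed.

Lemma mahonianS n : mahonian n.+1 = mahonian n * unif n.+1.
Proof. by rewrite /mahonian big_ord_recr. Qed.

Lemma mahonianE n : mahonian n = n`!%:R^-1 *: qfact R n.
Proof.
elim: n => [|n IH]; first by rewrite /mahonian big_ord0 qfact0 fact0 invr1 scale1r.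
rewrite mahonianS IH /unif -scalerAl -scalerAr scalerA qfactS factS natrM.
by rewrite invfM [in RHS]mulrC.
Qed.

Lemma mahonian_nneg n : nneg_coefs (mahonian n).
Proof.
elim: n => [|n IH]; first by rewrite /mahonian big_ord0; exact: nneg_coefs1.
by rewrite mahonianS; apply: nneg_coefsM => //; exact: unif_nneg.
Qed.

Lemma mahonian1 n : (mahonian n).[1] = 1.
Proof. by apply: horner_prod1 => i; apply: unif1. Qed.

Lemma mean_mahonian n : mean (mahonian n) = n%:R * (n%:R - 1) / 4.
Proof.
elim: n => [|n IH]; first by rewrite /mahonian big_ord0 mean1 !mul0r.
by rewrite mahonianS mean_mul ?mahonian1 ?unif1 // IH mean_unif // -natr1; field.
Qed.

Lemma var_mahonian n :
  var (mahonian n) = n%:R * (n%:R - 1) * (2 * n%:R + 5) / 72.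
Proof.
elim: n => [|n IH]; first by rewrite /mahonian big_ord0 var1 !mul0r.
by rewrite mahonianS var_mul ?mahonian1 ?unif1 // IH var_unif // -natr1; field.
Qed.

Lemma qbinomial_nneg a b : exists2 c : {poly R}, nneg_coefs c &
  qfact R (a + b) = c * (qfact R a * qfact R b).
Proof.
have [n] := ubnP (a + b); elim: n a b => // n IH [|a] [|b] ab.
- by exists 1; [exact: nneg_coefs1|]; rewrite qfact0 !mul1r.
- by exists 1; [exact: nneg_coefs1|]; rewrite qfact0 !mul1r.
- by exists 1; [exact: nneg_coefs1|]; rewrite qfact0 mulr1 mul1r addn0.
have [|c1 c1n e1] := IH a b.+1; first by rewrite addSn in ab.
have [|c2 c2n e2] := IH a.+1 b; first by rewrite addnS in ab.
exists (c1 + 'X^(a.+1) * c2); first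
  by apply: nneg_coefsD => //; apply: nneg_coefsM => //; exact: nneg_coefsXn.
have -> : qfact R (a.+1 + b.+1) =
    qfact R (a + b.+1) * qint R a.+1 + qfact R (a.+1 + b) * 'X^(a.+1) * qint R b.+1.
  have -> : (a + b.+1 = a.+1 + b)%N by rewrite addSnnS.
  by rewrite -mulrA -mulrDr -qintD [in LHS]addnS qfactS addnS.
by rewrite e1 e2 !qfactS; ring.
Qed.

Lemma qfact_sum_nneg (I : Type) (r : seq I) (k : I -> nat) :
  exists2 c : {poly R}, nneg_coefs c &
    qfact R (\sum_(i <- r) k i) = c * \prod_(i <- r) qfact R (k i).
Proof.
elim: r => [|i r [c cn e]].
  by exists 1; [exact: nneg_coefs1|]; rewrite !big_nil qfact0 mul1r.
have [c' c'n e'] := qbinomial_nneg (k i) (\sum_(i <- r) k i).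
exists (c' * c); first exact: nneg_coefsM.
by rewrite !big_cons e' e; ring.
Qed.

Lemma qmultinomial_nneg n m (k : 'I_m -> nat) : (\sum_(i < m) k i)%N = n ->
  nneg_coefs (qmultinomial R n k).
Proof.
move=> kn; have [c cn e] := qfact_sum_nneg (index_enum 'I_m) k.
have -> // : qmultinomial R n k = c.
rewrite kn -(qmultinomialK _ kn) in e; apply: mulIf e.
by rewrite prodf_seq_neq0; apply/allP => i _; rewrite qfact_neq0.
Qed.

End mahonian.

(** * Letter counts of random words *)

Section random_words.
Variables (R : realFieldType) (m : nat).
Hypothesis m_gt0 : (0 < m)%N.
Implicit Types (k : 'I_m -> nat) (F G : ('I_m -> nat) -> R).

Definition incr (i : 'I_m) k : 'I_m -> nat := fun j => (k j + (j == i))%N.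

(* Mean value of F at the vector of letter counts of a uniform random word of
   length n over an alphabet of m letters. *)
Fixpoint wavg (n : nat) F : R :=
  if n is n'.+1 then m%:R^-1 * \sum_(i < m) wavg n' (F \o incr i)
  else F (fun=> 0%N).

Let m_neq0 : m%:R != 0 :> R. Proof. by rewrite pnatr_eq0 -lt0n. Qed.

Lemma sum_incr i k : (\sum_j incr i k j = (\sum_j k j).+1)%N.
Proof.
rewrite /incr big_split /= -[RHS]addn1; congr (_ + _)%N.
by rewrite (bigD1 i) //= eqxx big1 // => j /negbTE ->.
Qed.

Lemma ler_wavg n F G : (forall k, (\sum_j k j)%N = n -> F k <= G k) ->
  wavg n F <= wavg n G.
Proof.
elim: n F G => [|n IH] F G FG /=; first by apply: FG; rewrite big1.
rewrite ler_wpM2l ?invr_ge0 //; apply: ler_sum => i _; apply: IH => k kn.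
by apply: FG; rewrite sum_incr kn.
Qed.

Lemma eq_wavg n F G : (forall k, (\sum_j k j)%N = n -> F k = G k) ->
  wavg n F = wavg n G.
Proof.
by move=> FG; apply/le_anti/andP; split; apply: ler_wavg => k /FG ->.
Qed.

Lemma wavg_cst n c : wavg n (fun=> c) = c.
Proof.
elim: n => //= n IH; rewrite (eq_bigr (fun=> c)) => [|i _]; last exact: IH.
by rewrite sumr_const card_ord -[c *+ m]mulr_natl mulKf.
Qed.

Lemma wavgD n F G : wavg n (fun k => F k + G k) = wavg n F + wavg n G.
Proof.
elim: n F G => //= n IH F G; rewrite -mulrDr -big_split /=.
by congr (_^-1 * _); apply: eq_bigr => i _; exact: IH.
Qed.

Lemma wavgZ n c F : wavg n (fun k => c * F k) = c * wavg n F.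
Proof.
elim: n F => //= n IH F; rewrite [RHS]mulrCA [c * _]mulr_sumr; congr (_ * _).
by apply: eq_bigr => i _; exact: IH.
Qed.

Lemma wavg_sum n I (r : seq I) (F : I -> ('I_m -> nat) -> R) :
  wavg n (fun k => \sum_(i <- r) F i k) = \sum_(i <- r) wavg n (F i).
Proof.
elim: r => [|i r IH].
  by rewrite big_nil -[RHS](wavg_cst n 0); apply: eq_wavg => k _; rewrite big_nil.
by rewrite big_cons -IH -wavgD; apply: eq_wavg => k _; rewrite big_cons.
Qed.

Lemma wavg_ge0 n F : (forall k, (\sum_j k j)%N = n -> 0 <= F k) -> 0 <= wavg n F.
Proof. by move=> F0; rewrite -(wavg_cst n 0); exact: ler_wavg. Qed.

Lemma wavgS n F : wavg n.+1 F =
  wavg n (fun k => m%:R^-1 * \sum_(i < m) F (incr i k)).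
Proof. by rewrite wavgZ wavg_sum. Qed.

Definition pairs k : R := \sum_(i < m) (k i)%:R * ((k i)%:R - 1) / 2.

Lemma pairs_incr i k : pairs (incr i k) = pairs k + (k i)%:R.
Proof.
rewrite /pairs (bigD1 i) //= [in RHS](bigD1 i) //=.
rewrite addrAC; congr (_ + _); last first.
  by apply: eq_bigr => j /negbTE ji; rewrite /incr ji addn0.
by rewrite /incr eqxx addn1 -natr1; field.
Qed.

Lemma sum_natr_word n k : (\sum_j k j)%N = n -> \sum_j (k j)%:R = n%:R :> R.
Proof. by move=> <-; rewrite natr_sum. Qed.

Lemma wavg_pairs n : wavg n pairs = n%:R * (n%:R - 1) / (2 * m%:R).
Proof.
elim: n => [|n IH]; first by rewrite /= /pairs big1 ?mul0r // => i _; rewrite !mul0r.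
rewrite wavgS; transitivity (wavg n (fun k => pairs k + n%:R / m%:R)).
  apply: eq_wavg => k kn; under eq_bigr do rewrite pairs_incr.
  rewrite big_split /= sumr_const card_ord (sum_natr_word kn).
  by rewrite -[pairs k *+ m]mulr_natl; field.
by rewrite wavgD wavg_cst IH -natr1; field.
Qed.

Lemma wavg_pairs_sqr n : wavg n (fun k => pairs k ^+ 2) =
  (n%:R * (n%:R - 1) / (2 * m%:R)) ^+ 2 +
  n%:R * (n%:R - 1) / 2 * m%:R^-1 * (1 - m%:R^-1).
Proof.
elim: n => [|n IH].
  by rewrite /= /pairs big1 => [|i _]; [field | rewrite !mul0r].
rewrite wavgS; transitivity (wavg n (fun k => pairs k ^+ 2 +
    ((2 * n%:R / m%:R + 2 / m%:R) * pairs k + n%:R / m%:R))).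
  apply: eq_wavg => k kn.
  transitivity (m%:R^-1 * \sum_i (pairs k ^+ 2 + (2 * pairs k) * (k i)%:R
     + (2 * ((k i)%:R * ((k i)%:R - 1) / 2) + (k i)%:R))).
    by congr (_ * _); apply: eq_bigr => i _; rewrite pairs_incr; field.
  rewrite !big_split /= sumr_const card_ord -!mulr_sumr (sum_natr_word kn).
  by rewrite -/(pairs k) -[_ ^+ 2 *+ m]mulr_natl; field.
by rewrite wavgD wavgD wavgZ wavg_cst IH wavg_pairs -natr1; field.
Qed.

Lemma wavg_pairs_var n :
  wavg n (fun k => (pairs k - n%:R * (n%:R - 1) / (2 * m%:R)) ^+ 2) =
  n%:R * (n%:R - 1) / 2 * m%:R^-1 * (1 - m%:R^-1).
Proof.
set c := _ / _; transitivity (wavg n (fun k => pairs k ^+ 2 +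
    ((- 2 * c) * pairs k + c ^+ 2))).
  by apply: eq_wavg => k _; ring.
by rewrite wavgD wavgD wavgZ wavg_cst wavg_pairs_sqr wavg_pairs -/c; ring.
Qed.

Definition mcoef n k : R := n`!%:R / (\prod_i (k i)`!)%:R.

Lemma mcoef_gt0 n k : 0 < mcoef n k.
Proof. by rewrite divr_gt0 // ltr0n ?fact_gt0 // prodn_gt0 // => i; rewrite fact_gt0. Qed.

Lemma mcoef_incr n i k : mcoef n k = (k i).+1%:R * mcoef n (incr i k).
Proof.
rewrite /mcoef (bigD1 i) //= [in RHS](bigD1 i) //= /incr eqxx addn1 factS.
rewrite [in RHS](eq_bigr (fun j => (k j)`!)) => [|j /negbTE -> //]; last by rewrite addn0.
rewrite !natrM; field; rewrite !pnatr_eq0 -!lt0n fact_gt0 prodn_gt0 /= => [|j].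
  by rewrite addrC natr1 pnatr_eq0.
exact: fact_gt0.
Qed.

(* Pascal's rule: a multinomial coefficient is the sum of those obtained by
   removing one letter. *)
Lemma wavgE n N F : (n <= N)%N ->
  m%:R ^+ n * wavg n F =
  \sum_(k : {ffun 'I_m -> 'I_N.+1} | (\sum_i k i)%N == n)
    mcoef n (fun i => k i : nat) * F (fun i => k i : nat).
Proof.
elim: n F => [|n IH] F nN.
  rewrite (big_pred1 [ffun=> ord0]) => [|k] /=; last first.
    rewrite sum_nat_eq0; apply/forallP/eqP => [k0|-> i]; last by rewrite ffunE.
    by apply/ffunP => i; rewrite ffunE; apply/val_inj/eqP/(k0 i).
  have -> : (fun i => ([ffun=> ord0] : {ffun 'I_m -> 'I_N.+1}) i : nat) = (fun=> 0%N).
    by apply: funext => i; rewrite ffunE.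
  by rewrite /mcoef big1 // fact0 divr1.
rewrite /= mulrA exprSr mulfK // mulr_sumr.
rewrite (eq_bigr _ (fun i _ => IH (F \o incr i) (ltnW nN))).
transitivity (\sum_(i < m) \sum_(k : {ffun 'I_m -> 'I_N.+1} |
   ((\sum_j k j)%N == n.+1) && (0 < k i)%N)
   (k i)%:R * mcoef n (fun j => k j : nat) * F (fun j => k j : nat)).
  apply: eq_bigr => i _; symmetry.
  pose h (k : {ffun 'I_m -> 'I_N.+1}) : {ffun 'I_m -> 'I_N.+1} :=
    [ffun j => inord (k j + (j == i))].
  pose g (k : {ffun 'I_m -> 'I_N.+1}) : {ffun 'I_m -> 'I_N.+1} :=
    [ffun j => inord (k j - (j == i))].
  have hE (k : {ffun 'I_m -> 'I_N.+1}) : (k i < N)%N ->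
      (fun j => h k j : nat) = incr i (fun j => k j : nat).
    move=> kN; apply: funext => j; rewrite ffunE /incr inordK //.
    by case: eqP => [->|_]; rewrite ?addn1 ?addn0.
  rewrite (reindex_onto h g) /=; last first.
    move=> k /andP[_ ki]; apply/ffunP => j; rewrite !ffunE; apply: val_inj => /=.
    rewrite (@inordK _ (k j - _)); last exact: leq_ltn_trans (leq_subr _ _) (ltn_ord _).
    by rewrite subnK ?inordK //; case: eqP => [->|].
  apply: eq_big => [k|k].
    apply/idP/idP => [/andP[/andP[/eqP hk hi] /eqP gk]|/eqP kn].
      have kN : (k i < N)%N.
        rewrite ltn_neqAle -ltnS ltn_ord andbT; apply: contraTN hi => /eqP e.
        by rewrite ffunE eqxx e addn1 /inord /insubd insubF ?ltnn.
      by rewrite -eqSS -(sum_incr i (fun j => k j : nat)) -(hE _ kN) hk.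
    have kN : (k i < N)%N.
      by apply: leq_ltn_trans nN; rewrite -kn (bigD1 i) //= leq_addr.
    have e j : h k j = (k j + (j == i))%N :> nat by rewrite -[LHS]/((fun j => h k j : nat) j) hE.
    rewrite (eq_bigr _ (fun j _ => e j)) -/(incr i (fun j => k j : nat)) sum_incr kn eqxx.
    rewrite e eqxx addn1 /=; apply/eqP/ffunP => j; rewrite ffunE e addnK.
    by apply/val_inj; rewrite /= inordK.
  move=> /andP[/andP[_ hi] _].
  have kN : (k i < N)%N.
    rewrite ltn_neqAle -ltnS ltn_ord andbT; apply: contraTN hi => /eqP e.
    by rewrite ffunE eqxx e addn1 /inord /insubd insubF ?ltnn.
  rewrite hE // [mcoef n (fun i => k i : nat)](mcoef_incr n i) /=.
  by rewrite -[h k i : nat]/((fun j => h k j : nat) i) hE // /incr eqxx addn1.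
rewrite (exchange_big_dep
  (fun k : {ffun 'I_m -> 'I_N.+1} => (\sum_j k j)%N == n.+1)) /=; last first.
  by move=> i k _ /andP[].
apply: eq_bigr => k /eqP kn.
transitivity (\sum_i (k i)%:R * mcoef n (fun j => k j : nat) * F (fun j => k j : nat)).
  rewrite [RHS](bigID (fun i => 0 < k i)%N) /= [X in _ = _ + X]big1 ?addr0.
    by apply: eq_bigl => i; rewrite kn eqxx.
  by move=> i; rewrite -eqn0Ngt => /eqP ->; rewrite !mul0r.
rewrite -mulr_suml -mulr_suml (sum_natr_word kn) /mcoef factS natrM.
by rewrite mulrA.
Qed.

Lemma galois_wavg n f :
  pexp ((m%:R ^- n) *: galois R m n) f =
  wavg n (fun k => pexp ((mcoef n k)^-1 *: qmultinomial R n k) f).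
Proof.
rewrite pexpZ; apply: (mulfI (expf_neq0 n m_neq0)).
rewrite mulVKf ?expf_neq0 // (wavgE _ (leqnn n)) pexp_sum.
apply: eq_bigr => k _; rewrite pexpZ mulVKf // gt_eqF //; exact: mcoef_gt0.
Qed.

End random_words.

(** * Coupling with random permutations *)

Section coupling.
Variables (R : realFieldType) (m n : nat).
Hypothesis m_gt0 : (0 < m)%N.
Implicit Types k : 'I_m -> nat.

Local Notation wavg := (@wavg R m n).
Local Notation pairs := (@pairs R m).

Let m_neq0 : m%:R != 0 :> R. Proof. by rewrite pnatr_eq0 -lt0n. Qed.

(* Inversions of a uniform arrangement of the letters of content k, and
   inversions of independent uniform permutations of each of the classes of
   equal letters: their sum is distributed as the number of inversions of a
   uniform permutation, whatever k is. *)
Definition arrangement k : {poly R} := (mcoef R n k)^-1 *: qmultinomial R n k.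
Definition tiebreak k : {poly R} := \prod_i mahonian R (k i).

Lemma arrangementM k : (\sum_j k j)%N = n ->
  arrangement k * tiebreak k = mahonian R n.
Proof.
move=> kn; rewrite /arrangement /tiebreak mahonianE -(qmultinomialK R kn).
rewrite (eq_bigr (fun i => ((k i)`!%:R^-1)%:P * qfact R (k i))) => [|i _].
  rewrite big_split /= -scalerAl mulrCA -rmorph_prod /= mul_polyC scalerA.
  congr (_ *: _); rewrite /mcoef natr_prod prodfV; field.
  rewrite !pnatr_eq0 -!lt0n fact_gt0 /=; apply/prodf_neq0 => i _.
  by rewrite pnatr_eq0 -lt0n fact_gt0.
by rewrite mahonianE mul_polyC.
Qed.

Lemma tiebreak_nneg k : nneg_coefs (tiebreak k).
Proof.
rewrite /tiebreak; elim/big_rec: _ => [|i p _ p0]; first exact: nneg_coefs1.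
by apply: nneg_coefsM => //; exact: mahonian_nneg.
Qed.

Lemma tiebreak1 k : (tiebreak k).[1] = 1.
Proof. by apply: horner_prod1 => i; exact: mahonian1. Qed.

Lemma arrangement_nneg k : (\sum_j k j)%N = n -> nneg_coefs (arrangement k).
Proof.
move=> kn; apply: nneg_coefsZ; first by rewrite invr_ge0 ltW ?mcoef_gt0.
exact: qmultinomial_nneg.
Qed.

Lemma arrangement1 k : (\sum_j k j)%N = n -> (arrangement k).[1] = 1.
Proof.
move=> /arrangementM/(congr1 (horner^~ 1)); rewrite hornerM tiebreak1 mulr1.
by rewrite mahonian1.
Qed.

Lemma mean_tiebreak k : mean (tiebreak k) = pairs k / 2.
Proof.
rewrite mean_prod => [|i]; last exact: mahonian1.
rewrite mulr_suml; apply: eq_bigr => i _; by rewrite mean_mahonian; field.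
Qed.

Lemma var_tiebreak k : (\sum_j k j)%N = n ->
  var (tiebreak k) <= (2 * n%:R + 5) / 36 * pairs k.
Proof.
move=> kn; rewrite var_prod => [|i]; last exact: mahonian1.
rewrite mulr_sumr; apply: ler_sum => i _; rewrite var_mahonian.
have ki : (k i)%:R <= n%:R :> R by rewrite ler_nat -kn (bigD1 i) //= leq_addr.
have k0 : 0 <= (k i)%:R * ((k i)%:R - 1) :> R.
  by case: (k i) => [|l]; rewrite ?mul0r // -natr1 addrK mulr_ge0 // addr_ge0.
nra.
Qed.

Lemma mean_arrangement k : (\sum_j k j)%N = n ->
  mean (arrangement k) = mean (mahonian R n) - pairs k / 2.
Proof.
move=> kn; rewrite -(arrangementM kn) mean_mul ?tiebreak1 ?arrangement1 //.
by rewrite mean_tiebreak addrK.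
Qed.

Lemma var_arrangement k : (\sum_j k j)%N = n ->
  var (arrangement k) = var (mahonian R n) - var (tiebreak k).
Proof.
move=> kn; rewrite -(arrangementM kn) var_mul ?tiebreak1 ?arrangement1 //.
by rewrite addrK.
Qed.

Definition galois_pgf : {poly R} := (m%:R ^- n) *: galois R m n.

Lemma pexp_galois f : pexp galois_pgf f = wavg (fun k => pexp (arrangement k) f).
Proof. exact: galois_wavg. Qed.

Lemma galois_nneg : nneg_coefs galois_pgf.
Proof.
apply: nneg_coefsZ; first by rewrite invr_ge0 exprn_ge0.
move=> i; rewrite coef_sum; apply: sumr_ge0 => k /eqP kn.
exact: qmultinomial_nneg.
Qed.

Lemma galois1 : galois_pgf.[1] = 1.
Proof.
rewrite -[LHS]mulr1 -(pexp_cst _ 1) pexp_galois -[RHS](wavg_cst m_gt0 n).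
by apply: eq_wavg => k kn; rewrite pexp_cst arrangement1 // mulr1.
Qed.

Local Notation mu := (mean (mahonian R n)).

Lemma mean_galois : mean galois_pgf = mu - n%:R * (n%:R - 1) / (4 * m%:R).
Proof.
rewrite [LHS]pexp_galois; transitivity (wavg (fun k => mu + - 2^-1 * pairs k)).
  by apply: eq_wavg => k kn; rewrite -/(mean _) mean_arrangement //; field.
by rewrite wavgD wavgZ wavg_cst // wavg_pairs //; field.
Qed.

Definition tie_var : R := wavg (fun k => var (tiebreak k)).
Definition tie_mean_var : R :=
  n%:R * (n%:R - 1) / 8 * m%:R^-1 * (1 - m%:R^-1).

Lemma wavg_tie_mean_var :
  wavg (fun k => (mean (tiebreak k) - (mu - mean galois_pgf)) ^+ 2) = tie_mean_var.
Proof.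
transitivity (wavg (fun k => 4^-1 * (pairs k - n%:R * (n%:R - 1) / (2 * m%:R)) ^+ 2)).
  by apply: eq_wavg => k kn; rewrite mean_tiebreak mean_galois; field.
by rewrite wavgZ wavg_pairs_var // /tie_mean_var; field.
Qed.

Lemma tie_var_ge0 : 0 <= tie_var.
Proof. by apply: wavg_ge0 => // k _; apply: var_ge0; exact: tiebreak_nneg. Qed.

Lemma tie_mean_var_ge0 : 0 <= tie_mean_var.
Proof.
by rewrite -wavg_tie_mean_var; apply: wavg_ge0 => // k _; exact: sqr_ge0.
Qed.

Lemma tie_var_le : tie_var <= (n%:R ^+ 3) / m%:R.
Proof.
apply: le_trans (_ : wavg (fun k => (2 * n%:R + 5) / 36 * pairs k) <= _).
  by apply: ler_wavg => // k kn; exact: var_tiebreak.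
rewrite wavgZ wavg_pairs //.
have -> : (2 * n%:R + 5) / 36 * (n%:R * (n%:R - 1) / (2 * m%:R)) =
  ((2 * n%:R + 5) * n%:R * (n%:R - 1) / 72) / m%:R :> R by field.
rewrite ler_pM2r ?invr_gt0 ?ltr0n //.
case: n => [|l]; first by rewrite !(mulr0, mul0r) expr0n.
by rewrite -natr1; have : 0 <= l%:R :> R by []; nra.
Qed.

Lemma tie_mean_var_le : tie_mean_var <= (n%:R ^+ 3) / m%:R.
Proof.
have m1 : 0 < m%:R^-1 :> R by rewrite invr_gt0 ltr0n.
apply: (@le_trans _ _ (n%:R * (n%:R - 1) / 8 * m%:R^-1)).
  apply: ler_piMr; last by rewrite lerBlDr lerDl ltW.
  rewrite mulr_ge0 ?(ltW m1) // divr_ge0 //.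
  by case: n => [|l]; rewrite ?mul0r // -natr1 addrK mulr_ge0 // addr_ge0.
rewrite ler_pM2r //; case: n => [|l]; first by rewrite !(mulr0, mul0r) expr0n.
by rewrite -natr1; have : 0 <= l%:R :> R by []; nra.
Qed.

Lemma var_galois : var galois_pgf = var (mahonian R n) - tie_var + tie_mean_var.
Proof.
rewrite [LHS]pexp_galois -wavg_tie_mean_var /tie_var.
transitivity (wavg (fun k => var (mahonian R n) + (-1 * var (tiebreak k) +
   (mean (tiebreak k) - (mu - mean galois_pgf)) ^+ 2))).
  apply: eq_wavg => k kn; rewrite pexp_sqr_dist ?arrangement1 //.
  by rewrite var_arrangement // mean_arrangement // mean_tiebreak; ring.
by rewrite wavgD wavgD wavgZ wavg_cst //; ring.
Qed.

(* Young's inequality [|x| <= e + x ^ 2 / e] replaces the Cauchy-Schwarz bound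
   on the mean of [|x|]. *)
Lemma coupling_bound (h : R -> R) (L a u e : R) : 0 < e -> 0 <= L ->
  (forall x y, `|h x - h y| <= L * `|x - y|) ->
  `|pexp galois_pgf (fun i => h (a * (i%:R - mean galois_pgf)))
    - pexp (mahonian R n) (fun i => h (u * (i%:R - mu)))|
  <= L * (e + (2 * (a - u) ^+ 2 * var galois_pgf +
               2 * u ^+ 2 * (tie_var + tie_mean_var)) / e).
Proof.
move=> e0 L0 hL; set g := mean galois_pgf; set M := mean (mahonian R n).
pose D i j := h (a * (i%:R - g)) - h (u * ((i + j)%:R - M)).
pose B i j := (2 * (a - u) ^+ 2) * (i%:R - g) ^+ 2 +
  (2 * u ^+ 2) * (j%:R - (M - g)) ^+ 2.
have DB i j : `|D i j| <= L * (e + e^-1 * B i j).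
  apply: le_trans (hL _ _) _; rewrite ler_wpM2l //.
  set x := (X in `|X|); have xB : x ^+ 2 <= B i j.
    rewrite /x /B natrD.
    set s := (a - u) * (i%:R - g); set t := u * (j%:R - (M - g)).
    have -> : a * (i%:R - g) - u * (i%:R + j%:R - M) = s - t by rewrite /s /t; ring.
    rewrite -mulrA -exprMn -/s -mulrA -exprMn -/t.
    by have := sqr_ge0 (s + t); nra.
  apply: (@le_trans _ _ (e + e^-1 * x ^+ 2)); last first.
    by rewrite lerD2l ler_wpM2l // invr_ge0 ltW.
  rewrite -(ler_pM2l e0) mulrDr mulrA mulfV ?gt_eqF // mul1r -(real_normK (num_real x)).
  by have := normr_ge0 x; nra.
have -> : pexp galois_pgf (fun i => h (a * (i%:R - g)))
    - pexp (mahonian R n) (fun i => h (u * (i%:R - M))) =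
  wavg (fun k => pexp (arrangement k) (fun i => pexp (tiebreak k) (D i))).
  rewrite pexp_galois -[pexp (mahonian R n) _](wavg_cst m_gt0 n).
  rewrite -[- wavg _]mulN1r -wavgZ -wavgD.
  apply: eq_wavg => k kn; rewrite -[in LHS](arrangementM kn) pexpM -pexpZf -pexpDf.
  apply: eq_pexp => i; rewrite [RHS]pexpDf pexp_cst tiebreak1 mul1r -pexpZf.
  by congr (_ + _); apply: eq_pexp => j; rewrite mulN1r.
have -> : L * (e + (2 * (a - u) ^+ 2 * var galois_pgf +
               2 * u ^+ 2 * (tie_var + tie_mean_var)) / e) =
  wavg (fun k => pexp (arrangement k) (fun i => pexp (tiebreak k)
    (fun j => L * (e + e^-1 * B i j)))).
  rewrite -wavg_tie_mean_var /tie_var -wavgD.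
  rewrite -/g -/M [var _]pexp_galois -/g [_ / e]mulrC -!wavgZ -wavgD -wavgZ.
  rewrite -[X in X + _](wavg_cst m_gt0 n) -wavgD -wavgZ.
  apply: eq_wavg => k kn.
  rewrite -[in LHS](pexp_sqr_dist _ (tiebreak1 k)).
  under [RHS]eq_pexp => i do rewrite pexpZf pexpDf pexp_cst tiebreak1 mul1r
    pexpZf pexpDf pexp_cst tiebreak1 mul1r pexpZf.
  by rewrite pexpZf pexpDf pexp_cst arrangement1 // mul1r pexpZf pexpDf pexpZf
    pexp_cst arrangement1 // mul1r.
have mono F G : (forall i j, F i j <= G i j) -> forall k, (\sum_j k j)%N = n ->
    pexp (arrangement k) (fun i => pexp (tiebreak k) (F i)) <=
    pexp (arrangement k) (fun i => pexp (tiebreak k) (G i)).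
  move=> FG k kn; apply: ler_pexp => [|i]; first exact: arrangement_nneg.
  by apply: ler_pexp => //; exact: tiebreak_nneg.
rewrite ler_norml -mulN1r -wavgZ; apply/andP; split; last first.
  apply: ler_wavg => //; apply: mono => i j; exact: le_trans (ler_norm _) (DB i j).
apply: ler_wavg => // k kn; rewrite -pexpZf.
under eq_pexp do rewrite -pexpZf.
apply: mono kn => i j; rewrite mulN1r.
by have := DB i j; rewrite ler_norml => /andP[].
Qed.

End coupling.

(** * The Gaussian semigroup *)

Section gaussian.
Variable R : realType.
Local Notation mu := (@lebesgue_measure R).
Local Notation pdf := (@normal_pdf R 0).

Lemma lebesgue_measureDr (a : R) (A : set R) : measurable A ->
  pushforward mu ((fun y => y + a) : _ -> measurableTypeR R) A = mu A.
Proof.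
have mD : measurable_fun setT ((fun y => y + a) : R -> measurableTypeR R).
  exact: measurable_funD.
move=> mA; apply/esym/(lebesgue_measure_unique
   (mu := measure_function_pushforward__canonical__measure_function_Measure mu mD)) => //.
move=> _ [[b c]] _ <-.
rewrite /= /pushforward.
have -> : (fun y => y + a) @^-1` [set` Interval (BRight b) (BRight c)] =
    [set` `]b - a, c - a]%R].
  by apply/seteqP; split=> y /=; rewrite !in_itv /= ltrBlDr lerBrDr.
rewrite !lebesgue_measure_itv /= !lte_fin ltrD2r; case: ifP => // _.
by rewrite -!EFinD; congr (_%:E); ring.
Qed.

Lemma integral_translation (f : R -> \bar R) (a : R) :
  measurable_fun setT f -> (forall y, (0 <= f y)%E) ->
  (\int[mu]_y f (y + a)%R = \int[mu]_y f y)%E.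
Proof.
move=> mf f0; pose g : measurableTypeR R -> measurableTypeR R := fun y => y + a.
have mg : measurable_fun setT g by exact: measurable_funD.
transitivity (\int[mu]_(y in g @^-1` setT) (f \o g) y)%E => //.
rewrite -ge0_integral_pushforward //.
by apply: eq_measure_integral => A mA _; exact: lebesgue_measureDr.
Qed.

Lemma integral_reflection (f : R -> \bar R) :
  measurable_fun setT f -> (forall y, (0 <= f y)%E) ->
  (\int[mu]_y f (- y)%R = \int[mu]_y f y)%E.
Proof.
move=> mf f0; pose g : measurableTypeR R -> measurableTypeR R := fun y => - y.
have mg : measurable_fun setT g by exact: oppr_measurable.
transitivity (\int[mu]_(y in g @^-1` setT) (f \o g) y)%E => //.
rewrite -ge0_integral_pushforward //.
by apply: eq_measure_integral => A mA _; exact: lebesgue_measureN.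
Qed.

Lemma normal_pdf_gaussian (c s y : R) : s != 0 -> normal_pdf c s y =
  (Num.sqrt (s ^+ 2 * pi *+ 2))^-1 * expR (- (y - c) ^+ 2 / (s ^+ 2 *+ 2)).
Proof. by move=> s0; rewrite normal_pdfE. Qed.

Lemma normal_pdfN (s y : R) : s != 0 -> pdf s (- y) = pdf s y.
Proof. by move=> s0; rewrite !normal_pdf_gaussian // !subr0 sqrrN. Qed.

(* Completing the square. *)
Lemma normal_pdfM (s t u y : R) : 0 < s -> 0 < t ->
  let r := Num.sqrt (s ^+ 2 + t ^+ 2) in
  pdf t (u - y) * pdf s y = pdf r u * normal_pdf (s ^+ 2 * u / r ^+ 2) (s * t / r) y.
Proof.
move=> s0 t0 r.
have q0 : 0 < s ^+ 2 + t ^+ 2 by rewrite addr_gt0 // exprn_gt0.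
have r0 : 0 < r by rewrite sqrtr_gt0.
have r2 : r ^+ 2 = s ^+ 2 + t ^+ 2 by rewrite sqr_sqrtr // ltW.
rewrite !normal_pdf_gaussian ?gt_eqF ?divr_gt0 ?mulr_gt0 //.
rewrite !subr0 mulrACA -expRD -invfM -sqrtrM; last first.
  by rewrite mulrn_wge0 // mulr_ge0 ?sqr_ge0 // pi_ge0.
rewrite [RHS]mulrACA -expRD -invfM -sqrtrM; last first.
  by rewrite mulrn_wge0 // mulr_ge0 ?sqr_ge0 // pi_ge0.
congr ((Num.sqrt _)^-1 * expR _).
  by field; rewrite gt_eqF.
rewrite exprMn exprVn r2; field.
by rewrite !gt_eqF.
Qed.

Lemma normal_pdf_scale (s c y : R) : 0 < s -> 0 < c ->
  c * pdf (c * s) y = pdf s y * expR ((1 - c ^- 2) * (y ^+ 2 / (2 * s ^+ 2))).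
Proof.
move=> s0 c0; rewrite !normal_pdf_gaussian ?gt_eqF ?mulr_gt0 // !subr0.
rewrite -[in RHS]mulrA -expRD mulrA; congr (_ * expR _); last first.
  by field; rewrite !gt_eqF.
rewrite exprMn -mulrA -mulrnAr sqrtrM ?sqr_ge0 // sqrtr_sqr gtr0_norm //.
by rewrite invfM mulrA mulfV ?gt_eqF // mul1r.
Qed.

End gaussian.

Section gaussian_moments.
Variable R : realType.
Local Notation mu := (@lebesgue_measure R).
Local Notation pdf := (@normal_pdf R 0).
Implicit Types (f g : R -> R) (s c : R).

Definition gint s f := mu.-integrable setT (fun y => (f y * pdf s y)%:E).
Definition gE s f : R := \int[mu]_y (f y * pdf s y).

Lemma gintD s f g : gint s f -> gint s g -> gint s (fun y => f y + g y).
Proof.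
move=> fi gi; rewrite /gint.
under eq_fun do rewrite mulrDl EFinD.
exact: integrableD.
Qed.

Lemma gintZ s c f : gint s f -> gint s (fun y => c * f y).
Proof.
move=> fi; rewrite /gint.
under eq_fun do rewrite -mulrA EFinM.
exact: integrableZl.
Qed.

Lemma gE_D s f g : gint s f -> gint s g ->
  gE s (fun y => f y + g y) = gE s f + gE s g.
Proof.
move=> fi gi; rewrite /gE -RintegralD //.
by apply: eq_Rintegral => y _; rewrite mulrDl.
Qed.

Lemma gE_Z s c f : gint s f -> gE s (fun y => c * f y) = c * gE s f.
Proof.
move=> fi; rewrite /gE -RintegralZl //.
by apply: eq_Rintegral => y _; rewrite mulrA.
Qed.

Lemma gE_le s f g : gint s f -> gint s g -> (forall y, f y <= g y) ->
  gE s f <= gE s g.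
Proof.
by move=> fi gi fg; apply: le_Rintegral => // y _; rewrite ler_wpM2r ?normal_pdf_ge0.
Qed.

Lemma gint_le s f g : measurable_fun setT f -> (forall y, `|f y| <= g y) ->
  gint s g -> gint s f.
Proof.
move=> mf fg; apply: le_integrable => //.
  by apply/measurable_EFinP/measurable_funM => //; exact: measurable_normal_pdf.
move=> y _; rewrite lee_fin !normrM ler_wpM2r //.
by apply: le_trans (fg y) _; exact: ler_norm.
Qed.

Lemma gE_norm s f : gint s f -> `|gE s f| <= gE s (fun y => `|f y|).
Proof.
move=> fi; apply: le_trans (le_normr_Rintegral _ _) _ => //.
rewrite le_eqVlt; apply/orP; left; apply/eqP/eq_Rintegral => y _.
by rewrite normrM [`|pdf s y|]ger0_norm ?normal_pdf_ge0.
Qed.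

Lemma gint_cst s c : gint s (fun=> c).
Proof.
rewrite /gint; under eq_fun do rewrite EFinM.
by apply: integrableZl => //; exact: integrable_normal_pdf.
Qed.

Lemma gE_cst s c : gE s (fun=> c) = c.
Proof.
rewrite /gE RintegralZl //; last exact: integrable_normal_pdf.
by rewrite /Rintegral integral_normal_pdf mulr1.
Qed.

Section tilting.
Variables (s c : R).
Hypotheses (s0 : 0 < s) (c0 : 0 < c).

Let tilt y := expR ((1 - c ^- 2) * (y ^+ 2 / (2 * s ^+ 2))).

Lemma gint_expR : gint s tilt.
Proof.
rewrite /gint; under eq_fun do rewrite mulrC -normal_pdf_scale // EFinM.
by apply: integrableZl => //; exact: integrable_normal_pdf.
Qed.

Lemma gE_expR : gE s tilt = c.
Proof.
rewrite /gE; under eq_Rintegral do rewrite mulrC -normal_pdf_scale //.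
rewrite RintegralZl //; last exact: integrable_normal_pdf.
by rewrite /Rintegral integral_normal_pdf mulr1.
Qed.

End tilting.

Let wE s y : 0 < s -> y ^+ 2 = 2 * s ^+ 2 * (y ^+ 2 / (2 * s ^+ 2)).
Proof. by move=> s0; field; rewrite gt_eqF. Qed.

Let w_ge0 s y : 0 <= y ^+ 2 / (2 * s ^+ 2).
Proof.
by apply: divr_ge0; [exact: sqr_ge0|apply: mulr_ge0 => //; exact: sqr_ge0].
Qed.

Lemma gint_sqr s : 0 < s -> gint s (fun y => y ^+ 2).
Proof.
move=> s0; have s2 : 0 < s ^+ 2 by rewrite exprn_gt0.
apply: (@gint_le _ _ (fun y => (4 * s ^+ 2) * expR ((1 - 2 ^- 2) * (y ^+ 2 / (2 * s ^+ 2))))).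
- by apply: measurable_funX; exact: measurable_id.
- move=> y; rewrite ger0_norm ?sqr_ge0 // {1}(wE y s0); have := w_ge0 s y.
  set w := _ / _ => w0; have := expR_ge1Dx ((1 - 2 ^- 2) * w); nra.
- by apply: gintZ; apply: gint_expR => //; exact: ltr0n.
Qed.

Lemma gint_id s : 0 < s -> gint s (fun y => y).
Proof.
move=> s0; apply: (@gint_le _ _ (fun y => 1 + y ^+ 2)) => [//|y|].
  by rewrite -(real_normK (num_real y)); have := normr_ge0 y; nra.
by apply: gintD; [exact: gint_cst | exact: gint_sqr].
Qed.

(* [expR u >= 1 + u] applied to the exponential tilt of parameter c bounds the
   variance from one side, according to the sign of c - 1. *)
Lemma gE_sqr s : 0 < s -> gE s (fun y => y ^+ 2) = s ^+ 2.
Proof.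
move=> s0; have s2 : 0 < s ^+ 2 by rewrite exprn_gt0.
set V := gE _ _; pose v := V / (2 * s ^+ 2).
have VE : V = 2 * s ^+ 2 * v by rewrite /v; field; rewrite gt_eqF.
have vc c : 0 < c -> (1 - c ^- 2) * v <= c - 1.
  move=> c0; rewrite lerBrDl -[X in _ <= X](gE_expR s0 c0).
  rewrite -[X in X + _](gE_cst s) /v [_ * (V / _)]mulrA [_ * V / _]mulrAC -gE_Z;
    last exact: gint_sqr.
  rewrite -gE_D; [|exact: gint_cst|by apply: gintZ; exact: gint_sqr].
  apply: gE_le; [|exact: gint_expR|].
    by apply: gintD; [exact: gint_cst|apply: gintZ; exact: gint_sqr].
  move=> y; apply: le_trans (expR_ge1Dx _).
  by rewrite lerD2l [leRHS]mulrA mulrAC.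
suff e : v = 2^-1 by rewrite VE e; field.
have vlim e : 0 < e -> e < 1 -> `|2 * v - 1| <= 2 * e.
  move=> e0 e1; have k c : 0 < c -> (c ^+ 2 - 1) * v <= (c - 1) * c ^+ 2.
    move=> c0; have c2 : 0 < c ^+ 2 by rewrite exprn_gt0.
    have -> : (c ^+ 2 - 1) * v = ((1 - c ^- 2) * v) * c ^+ 2 by field; rewrite gt_eqF.
    by rewrite ler_pM2r // vc.
  have ka : 0 < 1 + e by lra.
  have kb : 0 < 1 - e by lra.
  have ha : v * (2 + e) <= (1 + e) ^+ 2.
    rewrite -(ler_pM2l e0); have := k _ ka; nra.
  have hb : (1 - e) ^+ 2 <= v * (2 - e).
    rewrite -(ler_pM2l e0); have := k _ kb; nra.
  rewrite ler_norml; apply/andP; split; nra.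
apply/eqP; rewrite -subr_eq0 -normr_le0; apply/ler_addgt0Pr => e e0; rewrite add0r.
have e'0 : 0 < Num.min e 2^-1 by rewrite lt_min e0 invr_gt0 ltr0n.
have e'1 : Num.min e 2^-1 < 1 by rewrite gt_min; apply/orP; right; lra.
have := vlim _ e'0 e'1.
have -> : 2 * v - 1 = 2 * (v - 2^-1) by field.
rewrite normrM ger0_norm // ler_pM2l // => h; apply: le_trans h _.
by rewrite ge_min lexx.
Qed.

Lemma gE_id s : 0 < s -> gE s (fun y => y) = 0.
Proof.
move=> s0; have i1 := gint_id s0; have i0 := gint_cst s 1; have iN := gintZ (-1) i1.
have i2 := gint_sqr s0.
have pos : gint s (fun y => 1 + y ^+ 2) by apply: gintD => //; exact: gint_cst.
have p1 : gint s (fun y => (1 + y ^+ 2) + y) by exact: gintD.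
have e : gE s (fun y => (1 + y ^+ 2) + y) = gE s (fun y => (1 + y ^+ 2) + -1 * y).
  rewrite /gE /Rintegral; congr fine.
  rewrite -integral_reflection; first last.
  - move=> y; rewrite lee_fin mulr_ge0 ?normal_pdf_ge0 //.
    by have := sqr_ge0 (y + 1); have := sqr_ge0 y; nra.
  - exact: (measurable_int mu p1).
  - apply: eq_integral => y _.
    by rewrite normal_pdfN ?gt_eqF // sqrrN mulN1r.
by move: e; rewrite !gE_D // gE_Z //; lra.
Qed.

Lemma gint_norm3 s : 0 < s -> gint s (fun y => `|y| ^+ 3) /\
  gE s (fun y => `|y| ^+ 3) <= 31 * s ^+ 3.
Proof.
move=> s0; have s2 : 0 < s ^+ 2 by rewrite exprn_gt0.
pose g y := s ^+ 3 + (15 * s ^+ 3) * expR ((1 - 2 ^- 2) * (y ^+ 2 / (2 * s ^+ 2))).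
have ig : gint s g.
  by apply: gintD; [exact: gint_cst | apply: gintZ; apply: gint_expR => //; exact: ltr0n].
have bg y : `|y| ^+ 3 <= g y.
  rewrite /g; have := w_ge0 s y; set w := _ / _ => w0.
  have y2 : `|y| = s * (`|y| / s) by field; rewrite gt_eqF.
  have -> : w = (`|y| / s) ^+ 2 / 2.
    by rewrite exprMn (real_normK (num_real y)) /w; field; rewrite gt_eqF.
  rewrite y2; set z := `|y| / s.
  have -> : s * z / s = z by field; rewrite gt_eqF.
  have z0 : 0 <= z by rewrite divr_ge0 // ltW.
  have u0 : 0 <= (1 - 2 ^- 2) * (z ^+ 2 / 2) by nra.
  have := expR_ge1Dxn 1%N u0.
  have -> : 2`!%:R = 2 :> R by [].
  set E := expR _ => hE.
  rewrite exprMn; have -> : s ^+ 3 + 15 * s ^+ 3 * E = s ^+ 3 * (1 + 15 * E) by ring.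
  rewrite ler_wpM2l ?exprn_ge0 ?(ltW s0) //.
  have zz : z ^+ 3 <= 1 + z ^+ 4.
    have := sqr_ge0 (z ^+ 2 - z); have := sqr_ge0 (z - 1); have := sqr_ge0 z.
    have := sqr_ge0 (z ^+ 2 - 1); have -> : z ^+ 4 = (z ^+ 2) ^+ 2 by ring.
    have -> : z ^+ 3 = z ^+ 2 * z by ring.
    by nra.
  nra.
have m3 : measurable_fun setT (fun y : R => `|y| ^+ 3).
  by apply: measurable_funX; exact: normr_measurable.
have i3 : gint s (fun y => `|y| ^+ 3).
  by apply: (gint_le m3 _ ig) => y; rewrite ger0_norm ?exprn_ge0.
split => //; apply: le_trans (gE_le i3 ig bg) _.
rewrite gE_D; [|exact: gint_cst|by apply: gintZ; apply: gint_expR => //; exact: ltr0n].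
rewrite gE_cst gE_Z; last by apply: gint_expR => //; exact: ltr0n.
by rewrite gE_expR //; lra.
Qed.

End gaussian_moments.

Section gaussian_semigroup.
Variable R : realType.
Local Notation mu := (@lebesgue_measure R).
Local Notation pdf := (@normal_pdf R 0).
Implicit Types (h : R -> R) (s t x : R).

Definition unit_mfun h := measurable_fun setT h /\ forall x, 0 <= h x <= 1.

Definition gauss s h x : R := gE s (fun y => h (x + y)).

Lemma unit_mfun_shift h x : unit_mfun h -> unit_mfun (fun y => h (x + y)).
Proof.
by move=> [mh h01]; split => [|//]; apply: measurableT_comp => //; exact: measurable_funD.
Qed.

Lemma unit_gint s h x : unit_mfun h -> gint s (fun y => h (x + y)).
Proof.
move=> /(unit_mfun_shift x)[mh h01]; apply: (gint_le mh _ (gint_cst s 1)) => y.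
by have /andP[h0 h1] := h01 y; rewrite ger0_norm.
Qed.

Lemma gaussE s h x : unit_mfun h ->
  (gauss s h x)%:E = (\int[mu]_y (h (x + y) * pdf s y)%:E)%E.
Proof.
move=> uh; rewrite /gauss /gE /Rintegral fineK //.
by apply: integrable_fin_num => //; exact: unit_gint.
Qed.

Lemma gauss_unit s h : unit_mfun h -> unit_mfun (gauss s h).
Proof.
move=> uh; split => [|x]; last first.
  have ix := unit_gint s x uh; case: uh => _ h01.
  rewrite -{1}(gE_cst s 0) -(gE_cst s 1) /gauss !gE_le //; try exact: gint_cst.
  - by move=> y; have /andP[] := h01 (x + y).
  - by move=> y; have /andP[] := h01 (x + y).
have [mh h01] := uh.
pose f (z : R * R) := (h (z.1 + z.2) * pdf s z.2)%:E.
have mf : measurable_fun setT f.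
  apply/measurable_EFinP/measurable_funM.
    by apply: measurableT_comp => //; exact: measurable_funD.
  by apply: measurableT_comp => //; exact: measurable_normal_pdf.
have f0 z : (0 <= f z)%E.
  by rewrite lee_fin mulr_ge0 ?normal_pdf_ge0 //; have /andP[] := h01 (z.1 + z.2).
have := measurable_fun_fubini_tonelli_F (m2 := mu) f mf f0.
by move=> /(measurableT_comp (@fine_measurable R _ measurableT)).
Qed.

Lemma gauss_semigroup s t h x : 0 < s -> 0 < t -> unit_mfun h ->
  gauss s (gauss t h) x = gauss (Num.sqrt (s ^+ 2 + t ^+ 2)) h x.
Proof.
move=> s0 t0 uh; apply: EFin_inj; have [mh h01] := uh.
have h0 y : 0 <= h y by have /andP[] := h01 y.
set r := Num.sqrt _.
rewrite (gaussE s x (gauss_unit t uh)) (gaussE r x uh).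
pose f (z : R * R) := (h (x + z.2) * (pdf t (z.2 - z.1) * pdf s z.1))%:E.
have mf : measurable_fun setT f.
  apply/measurable_EFinP/measurable_funM.
    by apply: measurableT_comp => //; exact: measurable_funD.
  apply: measurable_funM.
    by apply: measurableT_comp; [exact: measurable_normal_pdf|exact: measurable_funB].
  by apply: measurableT_comp => //; exact: measurable_normal_pdf.
have f0 z : (0 <= f z)%E by rewrite lee_fin !mulr_ge0 ?normal_pdf_ge0.
transitivity (\int[mu]_y \int[mu]_u f (y, u))%E.
  apply: eq_integral => y _; rewrite EFinM gaussE //.
  rewrite -ge0_integralZr //; last 3 first.
  - apply/measurable_EFinP/measurable_funM; last exact: measurable_normal_pdf.
    by have [] := unit_mfun_shift (x + y) uh.
  - by move=> z _; rewrite lee_fin mulr_ge0 ?normal_pdf_ge0.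
  - by rewrite lee_fin normal_pdf_ge0.
  rewrite -[LHS](integral_translation (- y)).
  - apply: eq_integral => u _; rewrite /f /= -EFinM mulrA.
    by congr ((h _ * _ * _)%:E); ring.
  - apply: emeasurable_funM => //.
    apply/measurable_EFinP/measurable_funM; last exact: measurable_normal_pdf.
    by have [] := unit_mfun_shift (x + y) uh.
  - by move=> z; rewrite -EFinM lee_fin !mulr_ge0 ?normal_pdf_ge0.
rewrite fubini_tonelli //; apply: eq_integral => u _.
rewrite /f /=; under eq_integral do rewrite normal_pdfM // -/r mulrA EFinM.
rewrite ge0_integralZl //.
- by rewrite integral_normal_pdf mule1.
- by apply/measurable_EFinP; exact: measurable_normal_pdf.
- by move=> y _; rewrite lee_fin normal_pdf_ge0.
- by rewrite lee_fin mulr_ge0 ?normal_pdf_ge0.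
Qed.

Lemma gauss_dist s h1 h2 e x : unit_mfun h1 -> unit_mfun h2 ->
  (forall y, `|h1 y - h2 y| <= e) -> `|gauss s h1 x - gauss s h2 x| <= e.
Proof.
move=> u1 u2 he; have i1 := unit_gint s x u1; have i2 := gintZ (-1) (unit_gint s x u2).
have -> : gauss s h1 x - gauss s h2 x = gE s (fun y => h1 (x + y) + -1 * h2 (x + y)).
  by rewrite gE_D // gE_Z ?mulN1r //; exact: unit_gint.
have i12 := gintD i1 i2; apply: le_trans (gE_norm i12) _.
rewrite -[leRHS](gE_cst s e); apply: gE_le; last by move=> y; rewrite mulN1r.
- apply: (gint_le _ _ (gint_cst s e)); last by move=> y; rewrite normr_id mulN1r.
  apply: measurableT_comp => //; apply: measurable_funD.
    by have [] := unit_mfun_shift x u1.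
  by apply: measurable_funM => //; have [] := unit_mfun_shift x u2.
- exact: gint_cst.
Qed.

Definition cubic_taylor (C : R) h := exists h1 h2 : R -> R, forall x y,
  `|h (x + y) - (h x + h1 x * y + h2 x * y ^+ 2)| <= C * `|y| ^+ 3.

Lemma gauss_taylor s h (x a1 a2 C : R) : 0 < s -> 0 <= C -> unit_mfun h ->
  (forall y, `|h (x + y) - (h x + a1 * y + a2 * y ^+ 2)| <= C * `|y| ^+ 3) ->
  `|gauss s h x - (h x + a2 * s ^+ 2)| <= C * (31 * s ^+ 3).
Proof.
move=> s0 C0 uh hT.
have i1 := unit_gint s x uh.
have ic := gint_cst s (- h x).
have iy := gintZ (- a1) (gint_id s0).
have iy2 := gintZ (- a2) (gint_sqr s0).
have [i3 E3] := gint_norm3 s0.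
have j1 := gintD iy iy2; have j2 := gintD ic j1; have j3 := gintD i1 j2.
have -> : gauss s h x - (h x + a2 * s ^+ 2) =
  gE s (fun y => h (x + y) + (- h x + (- a1 * y + - a2 * y ^+ 2))).
  rewrite !gE_D // !gE_Z ?gE_cst ?gE_id ?gE_sqr //; first by rewrite /gauss; ring.
    exact: gint_sqr.
  exact: gint_id.
apply: le_trans (gE_norm j3) _.
apply: (@le_trans _ _ (gE s (fun y => C * `|y| ^+ 3))); last first.
  by rewrite gE_Z // ler_wpM2l.
have b y : `|h (x + y) + (- h x + (- a1 * y + - a2 * y ^+ 2))| <= C * `|y| ^+ 3.
  by apply: le_trans (hT y); rewrite le_eqVlt; apply/orP; left; apply/eqP; congr `|_|; ring.
apply: gE_le => //; last exact: gintZ.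
apply: (gint_le _ _ (gintZ C i3)) => [|y]; last by rewrite normr_id.
apply: measurableT_comp => //; apply: measurable_funD.
  by have [] := unit_mfun_shift x uh.
by apply: measurable_funD => //; apply: measurable_funD; apply: measurable_funM.
Qed.

End gaussian_semigroup.

(** * Smooth test functions *)

Section smooth_step.
Variable R : realType.
Implicit Types (x y u v a e : R).

Local Notation pos x := (Num.max 0 x).

Lemma cube_pos_taylor x y :
  `|pos (x + y) ^+ 3 - (pos x ^+ 3 + 3 * pos x ^+ 2 * y + 3 * pos x * y ^+ 2)|
  <= `|y| ^+ 3.
Proof.
rewrite -normrX; case: (leP 0 x) => x0; case: (leP 0 (x + y)) => xy0.
- by rewrite le_eqVlt; apply/orP; left; apply/eqP; congr `|_|; ring.
- rewrite [`|y ^+ 3|]ler0_norm; last by have : 0 <= y ^+ 2 := sqr_ge0 y; nra.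
  set z := x + y; have -> : x = z - y by rewrite /z; ring.
  have zy : y <= z by rewrite /z; lra.
  have -> : 0 ^+ 3 - ((z - y) ^+ 3 + 3 * (z - y) ^+ 2 * y + 3 * (z - y) * y ^+ 2) =
    y ^+ 3 - z ^+ 3 by ring.
  have z3 : z ^+ 3 <= 0 by rewrite exprn_odd_le0 // ltW.
  have y3 : y ^+ 3 <= z ^+ 3.
    rewrite -subr_ge0; have -> : z ^+ 3 - y ^+ 3 = (z - y) * (z ^+ 2 + z * y + y ^+ 2) by ring.
    by apply: mulr_ge0; nra.
  by rewrite ler_norml; apply/andP; split; lra.
- rewrite ger0_norm; last by rewrite !expr0n /=; have := sqr_ge0 (x + y); nra.
  rewrite [`|y ^+ 3|]ger0_norm; last by have := sqr_ge0 y; nra.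
  rewrite !expr0n /=; have := sqr_ge0 (x + y); have := sqr_ge0 x; nra.
- by rewrite !expr0n /= !(mulr0, mul0r, addr0) subrr normr0.
Qed.

(* Third difference of the truncated power of degree 3, that is the distribution
   function of the sum of three independent uniform variables on [0, 1]. *)
Definition sstep u : R :=
  (pos u ^+ 3 - 3 * pos (u - 1) ^+ 3 + 3 * pos (u - 2) ^+ 3 - pos (u - 3) ^+ 3) / 6.

Lemma sstep_le0 u : u <= 0 -> sstep u = 0.
Proof.
move=> u0; rewrite /sstep !max_l ?expr0n; first by rewrite /=; field.
all: lra.
Qed.

Lemma sstep_ge3 u : 3 <= u -> sstep u = 1.
Proof.
by move=> u3; rewrite /sstep !max_r; [field|lra|lra|lra|lra].
Qed.

Lemma sstep01 u : 0 <= sstep u <= 1.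
Proof.
have [u0|u0] := leP u 0; first by rewrite sstep_le0 ?lexx ?ler01.
have [u3|u3] := leP 3 u; first by rewrite sstep_ge3 ?lexx ?ler01.
rewrite /sstep (max_l (_ : u - 3 <= 0)); last by lra.
rewrite (max_r (_ : 0 <= u)); last by lra.
have [u1|u1] := leP (u - 1) 0.
  rewrite (max_l (_ : u - 2 <= 0)); last by lra.
  by rewrite !expr0n /=; have := sqr_ge0 u => ?; apply/andP; split; nra.
have [u2|u2] := leP (u - 2) 0.
  by rewrite !expr0n /=; have := sqr_ge0 u; have := sqr_ge0 (u - 1) => ? ?; apply/andP; split; nra.
rewrite !expr0n /=.
have -> : (u ^+ 3 - 3 * (u - 1) ^+ 3 + 3 * (u - 2) ^+ 3 - 0) / 6 = 1 - (3 - u) ^+ 3 / 6.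
  by field.
have : 0 <= 3 - u <= 1 by apply/andP; split; lra.
set z := 3 - u => /andP[z0 z1]; have := sqr_ge0 z => ?.
by apply/andP; split; nra.
Qed.

Lemma sstep_clamp u : sstep u = sstep (Num.min 3 (pos u)).
Proof.
have [u0|u0] := leP u 0.
  by rewrite (min_r (_ : 0 <= 3)) // !sstep_le0.
have [u3|u3] := leP 3 u; last by [].
by rewrite !sstep_ge3.
Qed.

Lemma pos_lipschitz x y : `|pos x - pos y| <= `|x - y|.
Proof.
have [xy|xy] := leP 0 (x - y); [rewrite [leRHS]ger0_norm // | rewrite [leRHS]ltr0_norm //];
  by rewrite ler_norml; case: (leP 0 x) => ?; case: (leP 0 y) => ?;
  apply/andP; split; lra.
Qed.

Lemma sstep_lipschitz u v : `|sstep u - sstep v| <= 36 * `|u - v|.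
Proof.
rewrite sstep_clamp [sstep v]sstep_clamp.
set p := Num.min _ _; set q := Num.min _ _.
have pq : `|p - q| <= `|u - v|.
  apply: le_trans (pos_lipschitz u v).
  rewrite /p /q; set a := pos u; set b := pos v.
  have [ab|ab] := leP 0 (a - b); [rewrite [leRHS]ger0_norm // | rewrite [leRHS]ltr0_norm //];
  by rewrite ler_norml; case: (leP 3 a) => ?; case: (leP 3 b) => ?;
  apply/andP; split; lra.
have p3 : p <= 3 by rewrite /p ge_min lexx.
have q3 : q <= 3 by rewrite /q ge_min lexx.
have cube (c : R) : 0 <= c -> `|pos (p - c) ^+ 3 - pos (q - c) ^+ 3| <= 27 * `|u - v|.
  move=> c0; set a := pos _; set b := pos (q - c).
  have a0 : 0 <= a by rewrite /a le_max lexx.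
  have b0 : 0 <= b by rewrite /b le_max lexx.
  have a3 : a <= 3 by rewrite /a ge_max; apply/andP; split; lra.
  have b3 : b <= 3 by rewrite /b ge_max; apply/andP; split; lra.
  have ab : `|a - b| <= `|u - v|.
    apply: le_trans (pos_lipschitz _ _) _; apply: le_trans pq.
    by rewrite le_eqVlt; apply/orP; left; apply/eqP; congr `|_|; ring.
  have -> : a ^+ 3 - b ^+ 3 = (a ^+ 2 + a * b + b ^+ 2) * (a - b) by ring.
  rewrite normrM; apply: ler_pM => //; rewrite ger0_norm; first by nra.
  by rewrite !addr_ge0 ?sqr_ge0 ?mulr_ge0.
have := cube 0 (lexx 0); have := cube 1 ler01.
have := cube 2 (ler0n _ _); have := cube 3 (ler0n _ _).
rewrite !subr0 /sstep !ler_norml.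
set a0 := pos p ^+ 3; set a1 := pos (p - 1) ^+ 3; set a2 := pos (p - 2) ^+ 3.
set a3 := pos (p - 3) ^+ 3; set b0 := pos q ^+ 3; set b1 := pos (q - 1) ^+ 3.
set b2 := pos (q - 2) ^+ 3; set b3 := pos (q - 3) ^+ 3.
move=> /andP[??] /andP[??] /andP[??] /andP[??]; apply/andP; split; lra.
Qed.

Lemma sstep_taylor : cubic_taylor 2 sstep.
Proof.
exists (fun x => (3 * pos x ^+ 2 - 3 * (3 * pos (x - 1) ^+ 2) +
   3 * (3 * pos (x - 2) ^+ 2) - 3 * pos (x - 3) ^+ 2) / 6).
exists (fun x => (3 * pos x - 3 * (3 * pos (x - 1)) +
   3 * (3 * pos (x - 2)) - 3 * pos (x - 3)) / 6) => x y.
have := cube_pos_taylor x y; have := cube_pos_taylor (x - 1) y.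
have := cube_pos_taylor (x - 2) y; have := cube_pos_taylor (x - 3) y.
have e (c : R) : x - c + y = x + y - c by ring.
rewrite !e /sstep !ler_norml.
move=> /andP[??] /andP[??] /andP[??] /andP[??].
have := exprn_ge0 3 (normr_ge0 y).
by move=> ?; apply/andP; split; lra.
Qed.

Lemma measurable_sstep : measurable_fun setT sstep.
Proof.
have m (c : R) : measurable_fun setT (fun u => pos (u - c) ^+ 3).
  apply: measurable_funX; apply: measurable_maxr => //; exact: measurable_funB.
have m0 : measurable_fun setT (fun u : R => pos u ^+ 3).
  by apply: measurable_funX; exact: measurable_maxr.
apply: measurable_funM => //; apply: measurable_funB => //; apply: measurable_funD.
  by apply: measurable_funB => //; apply: measurable_funM.
exact: measurable_funM.
Qed.

Definition ramp a e x := sstep ((x - a) / e).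

Lemma ramp_unit a e : unit_mfun (ramp a e).
Proof.
split => [|x]; last exact: sstep01.
apply: measurableT_comp; first exact: measurable_sstep.
by apply: measurable_funM => //; exact: measurable_funB.
Qed.

Lemma ramp_taylor a e : 0 < e -> cubic_taylor (2 / e ^+ 3) (ramp a e).
Proof.
move=> e0; have [h1 [h2 h12]] := sstep_taylor.
exists (fun x => h1 ((x - a) / e) / e); exists (fun x => h2 ((x - a) / e) / e ^+ 2) => x y.
have := h12 ((x - a) / e) (y / e).
have -> : (x - a) / e + y / e = (x + y - a) / e by ring.
have -> : 2 * `|y / e| ^+ 3 = 2 / e ^+ 3 * `|y| ^+ 3.
  by rewrite normrM normfV (gtr0_norm e0); field; rewrite gt_eqF.
apply: le_trans; rewrite le_eqVlt; apply/orP; left; apply/eqP; congr `|_|.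
by rewrite /ramp; field; rewrite gt_eqF.
Qed.

Lemma ramp_lipschitz a e x y : 0 < e -> `|ramp a e x - ramp a e y| <= 36 / e * `|x - y|.
Proof.
move=> e0; apply: le_trans (sstep_lipschitz _ _) _.
have -> : (x - a) / e - (y - a) / e = (x - y) / e by ring.
rewrite normrM normfV (gtr0_norm e0) le_eqVlt; apply/orP; left; apply/eqP.
by ring.
Qed.

Lemma ramp_eq0 a e x : 0 < e -> x <= a -> ramp a e x = 0.
Proof. by move=> e0 xa; apply: sstep_le0; rewrite pmulr_lle0 ?invr_gt0 // subr_le0. Qed.

Lemma ramp_eq1 a e x : 0 < e -> a + 3 * e <= x -> ramp a e x = 1.
Proof. by move=> e0 xa; apply: sstep_ge3; rewrite ler_pdivlMr // lerBrDl. Qed.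

End smooth_step.

(** * Central limit theorem for inversions *)

Section trotter.
Variable R : realType.
Implicit Types (h : R -> R) (p : {poly R}) (u s x C : R).

Definition smear u p h x : R := pexp p (fun j => h (x + u * (j%:R - mean p))).

Lemma smear_unit u p h : nneg_coefs p -> p.[1] = 1 -> unit_mfun h ->
  unit_mfun (smear u p h).
Proof.
move=> p0 p1 uh; have [mh h01] := uh; split => [|x].
  apply: measurable_sum => i; apply: measurable_funM => //.
  by apply: measurableT_comp => //; exact: measurable_funD.
apply/andP; split.
  by apply: pexp_ge0 => // i; have /andP[] := h01 (x + u * (i%:R - mean p)).
rewrite -[leRHS](mulr1 1) -{1}p1 -pexp_cst; apply: ler_pexp => // i.
by have /andP[] := h01 (x + u * (i%:R - mean p)).
Qed.

Lemma smear_taylor u p h C : nneg_coefs p -> p.[1] = 1 ->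
  cubic_taylor C h -> cubic_taylor C (smear u p h).
Proof.
move=> p0 p1 [h1 [h2 h12]]; exists (smear u p h1); exists (smear u p h2) => x y.
have -> : smear u p h (x + y) - (smear u p h x + smear u p h1 x * y +
    smear u p h2 x * y ^+ 2) =
  pexp p (fun j => let z := x + u * (j%:R - mean p) in
    h (z + y) - (h z + h1 z * y + h2 z * y ^+ 2)).
  transitivity (pexp p (fun j => h (x + y + u * (j%:R - mean p)) +
     (-1 * h (x + u * (j%:R - mean p)) + ((- y) * h1 (x + u * (j%:R - mean p)) +
      (- y ^+ 2) * h2 (x + u * (j%:R - mean p)))))).
    rewrite pexpDf pexpDf pexpDf (pexpZf _ (-1)) (pexpZf _ (- y)) (pexpZf _ (- y ^+ 2)).
    by rewrite /smear; ring.
  apply: eq_pexp => j; rewrite /= [x + y + _]addrAC; ring.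
apply: le_trans (ler_norm_pexp _ p0) _.
by rewrite -[leRHS]mul1r -p1 -pexp_cst; apply: ler_pexp => // j; exact: h12.
Qed.

Lemma smear_gauss u p h x C : 0 < u -> 0 <= C -> nneg_coefs p -> p.[1] = 1 ->
  0 < var p -> unit_mfun h -> cubic_taylor C h ->
  `|smear u p h x - gauss (u * Num.sqrt (var p)) h x| <=
  C * (pexp p (fun j => `|u * (j%:R - mean p)| ^+ 3) +
       31 * (u * Num.sqrt (var p)) ^+ 3).
Proof.
move=> u0 C0 p0 p1 v0 uh [h1 [h2 h12]]; set s := u * _.
have s0 : 0 < s by rewrite mulr_gt0 // sqrtr_gt0.
have s2 : s ^+ 2 = u ^+ 2 * var p by rewrite exprMn sqr_sqrtr // ltW.
have hG := gauss_taylor s0 C0 uh (h12 x).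
have hS : `|smear u p h x - (h x + h2 x * s ^+ 2)| <=
    C * pexp p (fun j => `|u * (j%:R - mean p)| ^+ 3).
  have -> : smear u p h x - (h x + h2 x * s ^+ 2) =
    pexp p (fun j => let y := u * (j%:R - mean p) in
      h (x + y) - (h x + h1 x * y + h2 x * y ^+ 2)).
    transitivity (pexp p (fun j => h (x + u * (j%:R - mean p)) +
       (- h x + ((- h1 x * u) * (j%:R - mean p) +
                 (- h2 x * u ^+ 2) * (j%:R - mean p) ^+ 2)))).
      rewrite pexpDf pexpDf pexpDf (pexpZf _ (- h1 x * u)) (pexpZf _ (- h2 x * u ^+ 2)).
      by rewrite pexp_cst p1 pexp_center // -/(var p) s2 /smear; ring.
    by apply: eq_pexp => j /=; ring.
  apply: le_trans (ler_norm_pexp _ p0) _.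
  by rewrite -pexpZf; apply: ler_pexp => // j; exact: h12.
rewrite mulrDr; set a := h x + _ in hG hS.
have -> : smear u p h x - gauss s h x = (smear u p h x - a) - (gauss s h x - a) by ring.
exact: le_trans (ler_normB _ _) (lerD hS hG).
Qed.

Lemma smear_unif_gauss u l n h x C : 0 < u -> 0 <= C -> (1 < l)%N -> (l <= n)%N ->
  unit_mfun h -> cubic_taylor C h ->
  `|smear u (unif R l) h x - gauss (u * Num.sqrt (var (unif R l))) h x| <=
  C * (32 * (u * n%:R) ^+ 3).
Proof.
move=> u0 C0 l1 ln uh hT; have l0 : (0 < l)%N by exact: ltn_trans l1.
have lR : 2 <= l%:R :> R by rewrite ler_nat.
have lnR : l%:R <= n%:R :> R by rewrite ler_nat.
have vE := var_unif R l0; have v0 : 0 < var (unif R l) by rewrite vE; nra.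
apply: le_trans (smear_gauss x u0 C0 (unif_nneg R l) (unif1 R l0) v0 uh hT) _.
have un0 : 0 <= u * n%:R by rewrite mulr_ge0 // ltW.
rewrite ler_wpM2l //; have -> : 32 * (u * n%:R) ^+ 3 = (u * n%:R) ^+ 3 + 31 * (u * n%:R) ^+ 3.
  by ring.
apply: lerD.
  rewrite pexp_unif mean_unif //.
  apply: (@le_trans _ _ (l%:R^-1 * \sum_(i < l) (u * n%:R) ^+ 3)); last first.
    by rewrite sumr_const card_ord -[(u * n%:R) ^+ 3 *+ l]mulr_natl mulKf // pnatr_eq0 -lt0n.
  rewrite ler_wpM2l ?invr_ge0 //; apply: ler_sum => i _.
  rewrite lerXn2r ?nnegrE // normrM (gtr0_norm u0) ler_pM2l //.
  have iR : i%:R + 1 <= l%:R :> R by rewrite natr1 ler_nat.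
  have i0 : 0 <= i%:R :> R by [].
  by rewrite ler_norml; apply/andP; split; lra.
rewrite ler_pM2l // lerXn2r ?nnegrE ?mulr_ge0 ?sqrtr_ge0 ?(ltW u0) // ler_pM2l //.
rewrite -[leRHS](ger0_norm (ler0n _ _)) -sqrtr_sqr ler_wsqrtr // vE.
nra.
Qed.

Lemma smear_mahonianS u n h x :
  smear u (mahonian R n.+1) h x = smear u (mahonian R n) (smear u (unif R n.+1) h) x.
Proof.
rewrite /smear mahonianS pexpM mean_mul ?mahonian1 ?unif1 //.
apply: eq_pexp => i; apply: eq_pexp => j; congr h.
by rewrite natrD; ring.
Qed.

Lemma smear1 u h : smear u 1 h = h.
Proof.
apply/funext => x; rewrite /smear mean1 -(expr0 'X) pexpXn.
by rewrite subrr mulr0 addr0.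
Qed.

Lemma var_mahonian_gt0 n : (1 < n)%N -> 0 < var (mahonian R n).
Proof.
move=> n1; have n2 : 2 <= n%:R :> R by rewrite ler_nat.
rewrite var_mahonian; apply: divr_gt0 => //.
by apply: mulr_gt0; [apply: mulr_gt0|]; lra.
Qed.

Lemma mahonian_1 : mahonian R 1 = 1.
Proof.
by rewrite /mahonian big_ord1 /unif qintE big_ord1 expr0 invr1 scale1r.
Qed.

(* Trotter's argument: the laws being compared are products of convolution
   operators, which are exchanged one at a time. *)
Lemma smear_mahonian_gauss u l n h x C : 0 < u -> 0 <= C -> (l.+2 <= n)%N ->
  unit_mfun h -> cubic_taylor C h ->
  `|smear u (mahonian R l.+2) h x - gauss (u * Num.sqrt (var (mahonian R l.+2))) h x|
  <= l.+2%:R * (C * (32 * (u * n%:R) ^+ 3)).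
Proof.
move=> u0 C0; set e := C * _.
have e0 : 0 <= e.
  apply: mulr_ge0 => //; apply: mulr_ge0 => //; apply: exprn_ge0.
  by rewrite mulr_ge0 // ltW.
elim: l h x => [|l IH] h x ln uh hT.
  have v2 : var (mahonian R 2) = var (unif R 2).
    by rewrite var_mahonian var_unif //; field.
  rewrite smear_mahonianS mahonian_1 smear1 v2.
  apply: le_trans (smear_unif_gauss x u0 C0 _ ln uh hT) _ => //.
  by rewrite -/e ler_peMl // ler1n.
set U := smear u (unif R l.+3) h.
have n3 := unif_nneg R l.+3; have one3 : (unif R l.+3).[1] = 1 by apply: unif1.
have uU : unit_mfun U by exact: smear_unit.
have tU : cubic_taylor C U by exact: smear_taylor.
rewrite smear_mahonianS -/U.
have h1 := IH U x (ltnW ln) uU tU.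
set s := u * Num.sqrt (var (mahonian R l.+2)) in h1.
set t := u * Num.sqrt (var (unif R l.+3)).
have vm0 : 0 < var (mahonian R l.+2) by exact: var_mahonian_gt0.
have l3 : 2 <= l.+3%:R :> R by rewrite ler_nat.
have vu0 : 0 < var (unif R l.+3) by rewrite var_unif //; nra.
have s0 : 0 < s by rewrite mulr_gt0 // sqrtr_gt0.
have t0 : 0 < t by rewrite mulr_gt0 // sqrtr_gt0.
have -> : u * Num.sqrt (var (mahonian R l.+3)) = Num.sqrt (s ^+ 2 + t ^+ 2).
  rewrite !exprMn !sqr_sqrtr ?(ltW vm0) ?(ltW vu0) // -mulrDr.
  rewrite sqrtrM ?sqr_ge0 // sqrtr_sqr gtr0_norm // (mahonianS R l.+2).
  by rewrite var_mul ?mahonian1.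
rewrite -gauss_semigroup //.
have h2 : `|gauss s U x - gauss s (gauss t h) x| <= e.
  apply: gauss_dist => // [|y]; first exact: gauss_unit.
  exact: smear_unif_gauss.
rewrite -[l.+3%:R]natr1 mulrDl mul1r.
rewrite -(subrKA (gauss s U x)); apply: le_trans (ler_normD _ _) _.
exact: lerD.
Qed.

Lemma mahonian_clt h C tau u n : u = tau / Num.sqrt (var (mahonian R n)) ->
  0 < tau -> 0 <= C -> (2 <= n)%N -> unit_mfun h -> cubic_taylor C h ->
  `|pexp (mahonian R n) (fun i => h (u * (i%:R - mean (mahonian R n))))
    - gauss tau h 0| ^+ 2 <= 32 ^+ 2 * C ^+ 2 * n%:R ^+ 2 * (72 * tau ^+ 2 / n%:R) ^+ 3.
Proof.
case: n => [//|[//|l]]; set n := l.+2 => uE tau0 C0 _ uh hT.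
have nR : 2 <= n%:R :> R by rewrite ler_nat.
have v0 : 0 < var (mahonian R n) by exact: var_mahonian_gt0.
have u0 : 0 < u by rewrite uE divr_gt0 // sqrtr_gt0.
have := smear_mahonian_gauss 0 u0 C0 (leqnn n) uh hT.
have -> : u * Num.sqrt (var (mahonian R n)) = tau.
  by rewrite uE divfK // gt_eqF // sqrtr_gt0.
have -> : smear u (mahonian R n) h 0 =
    pexp (mahonian R n) (fun i => h (u * (i%:R - mean (mahonian R n)))).
  by apply: eq_pexp => i; rewrite add0r.
set D := `|_| => hD.
have D0 : 0 <= D := normr_ge0 _.
set B := _ * _ in hD.
apply: (@le_trans _ _ (B ^+ 2)); first by rewrite lerXn2r ?nnegrE // (le_trans D0).
have u2 : (u * n%:R) ^+ 2 <= 72 * tau ^+ 2 / n%:R.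
  have -> : (u * n%:R) ^+ 2 = tau ^+ 2 * n%:R ^+ 2 / var (mahonian R n).
    by rewrite uE exprMn exprMn exprVn sqr_sqrtr ?ltW //; ring.
  have -> : 72 * tau ^+ 2 / n%:R = tau ^+ 2 * (72 / n%:R) by ring.
  rewrite -mulrA ler_wpM2l ?sqr_ge0 // ler_pdivrMr // var_mahonian.
  have -> : 72 / n%:R * (n%:R * (n%:R - 1) * (2 * n%:R + 5) / 72) =
    (n%:R - 1) * (2 * n%:R + 5) :> R by field; lra.
  by nra.
have n0 : 0 < n%:R :> R by lra.
have -> : B ^+ 2 = 32 ^+ 2 * C ^+ 2 * n%:R ^+ 2 * ((u * n%:R) ^+ 2) ^+ 3.
  by rewrite /B -/n; set z := u * _; ring.
rewrite ler_wpM2l ?mulr_ge0 ?sqr_ge0 // lerXn2r ?nnegrE ?sqr_ge0 //.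
by rewrite divr_ge0 ?mulr_ge0 ?sqr_ge0 // ltW.
Qed.

End trotter.

(** * Laws determined by a polynomial generating function *)

Section law_of_pgf.
Context d (T : measurableType d) (R : realType) (P : probability T R).
Variables (X : {RV P >-> nat}) (g : {poly R}).
Implicit Types f : nat -> R.

Let RE f : R := \int[P]_t (f (X t)).

Let measurable_comp f : measurable_fun setT (fun t => f (X t)).
Proof. exact: measurableT_comp (measurable_funPT X). Qed.

Let bint f (B : R) : (forall k, `|f k| <= B) ->
  P.-integrable setT (EFin \o (fun t => f (X t))).
Proof.
move=> fB; apply: (@le_integrable _ _ _ P setT measurableT _ (cst B%:E)) => //.
- by apply/measurable_EFinP; exact: measurable_comp.
- by move=> t _; rewrite lee_fin; apply: le_trans (fB _) (ler_norm _).
- exact: finite_measure_integrable_cst.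
Qed.

Let RE_D f h B : (forall k, `|f k| <= B) -> (forall k, `|h k| <= B) ->
  RE (fun k => f k + h k) = RE f + RE h.
Proof. by move=> fB hB; apply: RintegralD => //; apply: bint; eauto. Qed.

Let RE_Z c f B : (forall k, `|f k| <= B) -> RE (fun k => c * f k) = c * RE f.
Proof. by move=> fB; apply: RintegralZl => //; apply: bint; eauto. Qed.

Let p k : R := fine (P (X @^-1` [set k])).

Let measurable_pre (A : set nat) : measurable (X @^-1` A).
Proof. by rewrite -[X @^-1` A]setTI; apply: (measurable_funPT X). Qed.

Let RE_indic (A : set nat) : RE (fun k => \1_A k) = fine (P (X @^-1` A)).
Proof.
rewrite /RE /Rintegral.
have -> : (fun t => (\1_A (X t) : R)%:E) = (fun t => (\1_(X @^-1` A) t)%:E).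
  by apply/funext => t; rewrite !indicE.
by rewrite integral_indic ?setIT //; exact: measurable_pre.
Qed.

Let RE_le f h B : (forall k, `|f k| <= B) -> (forall k, `|h k| <= B) ->
  (forall k, f k <= h k) -> RE f <= RE h.
Proof.
by move=> fB hB fh; apply: le_Rintegral => //; apply: bint; eauto.
Qed.

Let RE_cst c : RE (fun=> c) = c.
Proof.
rewrite /RE (_ : \int[P]_t c = c * fine (P setT)); last exact: Rintegral_cst.
by rewrite probability_setT mulr1.
Qed.

Let trunc N f k : R := if (k < N)%N then f k else 0.

Let trunc_le N f k : `|trunc N f k| <= \sum_(j < N) `|f j|.
Proof.
rewrite /trunc; case: ltnP => kN; last by rewrite normr0 sumr_ge0.
by rewrite (bigD1 (Ordinal kN)) //= lerDl sumr_ge0.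
Qed.

Let RE_trunc N f : RE (trunc N f) = \sum_(j < N) f j * p j.
Proof.
elim: N => [|N IH]; first by rewrite big_ord0 -[RHS]RE_cst.
have indic_le k : `|\1_[set N] k : R| <= 1.
  by rewrite indicE; case: (_ \in _); rewrite ?normr1 ?normr0.
have -> : trunc N.+1 f = (fun k => trunc N f k + f N * \1_[set N] k).
  apply/funext => k; rewrite /trunc indicE ltnS leq_eqVlt.
  have -> : (k \in [set N]) = (k == N) by apply/idP/eqP => [|->]; rewrite inE.
  by have [->|kN] := eqVneq k N; rewrite ?ltnn ?mulr1 ?mulr0 ?add0r ?addr0 /=.
rewrite (RE_D (B := \sum_(j < N.+1) `|f j|)) => [||k].
- by rewrite (RE_Z _ (B := 1)) // RE_indic IH big_ord_recr.
- by move=> k; apply: le_trans (trunc_le _ _ _) _; rewrite big_ord_recr /= lerDl.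
- rewrite normrM big_ord_recr /=; apply: (@le_trans _ _ `|f N|).
    by rewrite ler_piMr.
  by rewrite lerDr sumr_ge0.
Qed.

Hypothesis X_pgf : has_pgf P X g.

Let pgfE q : `|q| <= 1 -> RE (fun k => q ^+ k) = g.[q].
Proof. by move=> /X_pgf; rewrite unlock /RE /Rintegral => ->. Qed.

Let pgf_tail k q : 0 < q -> q <= 1 ->
  `|g.[q] - \sum_(j < k.+1) q ^+ j * p j| <= q ^+ k.+1.
Proof.
move=> q0 q1; have q0' := ltW q0.
have pow1 j : `|q ^+ j| <= 1 by rewrite ger0_norm ?exprn_ge0 ?exprn_ile1.
have qn : `|q| <= 1 by rewrite ger0_norm.
rewrite -(pgfE qn) -(RE_trunc k.+1 (fun j => q ^+ j)).
set tr := trunc _ _; have tr1 j : `|-1 * tr j| <= 1.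
  by rewrite mulN1r normrN /tr /trunc; case: ifP; rewrite ?normr0.
have -> : RE (fun k => q ^+ k) - RE tr = RE (fun j => q ^+ j + -1 * tr j).
  rewrite (RE_D (B := 1)) // (RE_Z _ (B := 1)) ?mulN1r // => j.
  by have := tr1 j; rewrite mulN1r normrN.
have b j : 0 <= q ^+ j + -1 * tr j <= q ^+ k.+1.
  rewrite /tr /trunc mulN1r; case: ltnP => jk; rewrite ?subrr ?lexx ?exprn_ge0 //.
  by rewrite subr0 exprn_ge0 //= ler_wiXn2l.
have b1 j : `|q ^+ j + -1 * tr j| <= 1.
  have /andP[? ?] := b j; rewrite ger0_norm //; apply: le_trans (_ : q ^+ k.+1 <= _) => //.
  by rewrite exprn_ile1.
rewrite ger0_norm; last first.
  by rewrite -(RE_cst 0); apply: (RE_le (B := 1)) => // j; [rewrite normr0|have /andP[] := b j].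
by rewrite -(RE_cst (q ^+ k.+1)); apply: (RE_le (B := 1)) => // j; have /andP[] := b j.
Qed.

Let coef_tail k : exists2 C, 0 <= C & forall q, 0 < q -> q <= 1 ->
  `|g.[q] - \sum_(j < k.+1) q ^+ j * g`_j| <= C * q ^+ k.+1.
Proof.
exists (\sum_(i < size g) `|g`_(k.+1 + i)|); first exact: sumr_ge0.
move=> q q0 q1; rewrite (@horner_coef_wide _ (k.+1 + size g)%N) ?leq_addl //.
rewrite big_split_ord [X in X + _ - _](eq_bigr (fun j : 'I_k.+1 => q ^+ j * g`_j)) => [|j _].
  rewrite [_ + _ - _]addrAC subrr add0r; apply: le_trans (ler_norm_sum _ _ _) _.
  rewrite mulr_suml; apply: ler_sum => i _; rewrite normrM ler_wpM2l //.
  rewrite ger0_norm ?exprn_ge0 ?(ltW q0) // exprD ler_piMr ?exprn_ge0 ?(ltW q0) //.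
  by rewrite exprn_ile1 // ltW.
by rewrite mulrC.
Qed.

Let pE k : p k = g`_k.
Proof.
have [n] := ubnP k; elim: n k => // n IH k kn.
have [C C0 hC] := coef_tail k.
apply/eqP; rewrite -subr_eq0 -normr_le0 leNgt; apply/negP => D0.
set D := `|_| in D0.
have hD q : 0 < q -> q <= 1 -> D <= (1 + C) * q.
  move=> q0 q1; have := hC q q0 q1; have := pgf_tail k q0 q1.
  rewrite !big_ord_recr /= (eq_bigr (fun j : 'I_k => q ^+ j * g`_j)); last first.
    by move=> j _; rewrite IH // (leq_trans (ltn_ord j)).
  set S := \sum_(j < k) _ => h1 h2.
  have e : q ^+ k * (p k - g`_k) = (g.[q] - (S + q ^+ k * g`_k)) - (g.[q] - (S + q ^+ k * p k)).
    by ring.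
  have : `|q ^+ k * (p k - g`_k)| <= C * q ^+ k.+1 + q ^+ k.+1.
    by rewrite e; apply: le_trans (ler_normB _ _) (lerD h2 h1).
  rewrite normrM (ger0_norm (exprn_ge0 _ (ltW q0))) -/D exprS.
  have -> : C * (q * q ^+ k) + q * q ^+ k = q ^+ k * ((1 + C) * q) by ring.
  by rewrite ler_pM2l // exprn_gt0.
pose q := Num.min 1 (D / (2 * (1 + C))).
have C1 : 0 < 1 + C by lra.
have q0 : 0 < q by rewrite lt_min ltr01 divr_gt0 // mulr_gt0.
have q1 : q <= 1 by rewrite ge_min lexx.
have := hD q q0 q1.
have qD : q <= D / (2 * (1 + C)) by rewrite ge_min lexx orbT.
have : (1 + C) * q <= D / 2.
  have -> : D / 2 = (1 + C) * (D / (2 * (1 + C))) by field; lra.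
  by rewrite ler_pM2l.
by lra.
Qed.

Lemma expectation_pgf f : 'E_P[fun t => f (X t)]%E = (pexp g f)%:E.
Proof.
pose N := size g.
have p1 : RE (trunc N (fun=> 1)) = 1.
  rewrite RE_trunc -[RHS](RE_cst 1); transitivity g.[1].
    by rewrite horner_coef; apply: eq_bigr => i _; rewrite pE expr1n mul1r mulr1.
  by rewrite -pgfE ?normr1 //; congr RE; apply/funext => k; rewrite expr1n.
have tail0 : P (X @^-1` [set k | (N <= k)%N]) = 0%E.
  rewrite -[LHS]fineK ?fin_num_measure // -RE_indic.
  have -> : (fun k => \1_[set k | (N <= k)%N] k : R) = (fun k => 1 + -1 * trunc N (fun=> 1) k).
    apply/funext => k; rewrite indicE /trunc.
    have -> : (k \in [set k | (N <= k)%N]) = (N <= k)%N by apply/idP/idP; rewrite inE.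
    by case: leqP; rewrite ?mulr0 ?addr0 ?mulr1 ?subrr.
  have t1 k : `|trunc N (fun=> 1) k| <= 1 by rewrite /trunc; case: ifP; rewrite ?normr1 ?normr0.
  rewrite (RE_D (B := 1)) ?(RE_Z _ (B := 1)) ?RE_cst ?p1 ?mulr1 ?subrr // => k.
    by rewrite normr1.
  by rewrite mulN1r normrN.
have -> : pexp g f = RE (trunc N f).
  by rewrite RE_trunc; apply: eq_bigr => i _; rewrite pE mulrC.
rewrite unlock /RE /Rintegral fineK; last first.
  by apply: integrable_fin_num => //; apply: bint; exact: trunc_le.
apply: ae_eq_integral => //.
- by apply/measurable_EFinP; exact: measurable_comp.
- by apply/measurable_EFinP; exact: measurable_comp.
exists (X @^-1` [set k | (N <= k)%N]); split => //.
move=> t /=; apply: contra_notP => /negP; rewrite -ltnNge => tN _.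
by rewrite /trunc tN.
Qed.

Lemma expectation_natRV : 'E_P[natRV P X]%E = (mean g)%:E.
Proof. exact: (expectation_pgf (fun k : nat => k%:R)). Qed.

Lemma variance_natRV : 'V_P[natRV P X]%E = (var g)%:E.
Proof.
rewrite /variance covariance.unlock expectation_natRV /=.
rewrite -(expectation_pgf (fun k : nat => (k%:R - mean g) ^+ 2)).
by congr expectation.
Qed.

Lemma probability_pgf (A : set nat) : P (X @^-1` A) = (pexp g \1_A)%:E.
Proof.
rewrite -expectation_pgf unlock.
have -> : (fun t => (\1_A (X t) : R)%:E) = (fun t => (\1_(X @^-1` A) t)%:E).
  by apply/funext => t; rewrite !indicE.
by rewrite integral_indic ?setIT //; exact: measurable_pre.
Qed.

Lemma cdf_center_scale s x :
  cdf (center_scale P (natRV P X : {RV P >-> R}) s : {RV P >-> R}) x =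
  (pexp g (fun k => ((k%:R - mean g) / s <= x)%R%:R))%:E.
Proof.
have -> : pexp g (fun k => ((k%:R - mean g) / s <= x)%R%:R) =
    pexp g \1_[set k | (k%:R - mean g) / s <= x].
  apply: eq_pexp => k; rewrite indicE; congr ((nat_of_bool _)%:R).
  by apply/idP/idP; rewrite inE.
rewrite -probability_pgf /cdf /distribution /pushforward; congr (P _).
apply/seteqP; split => t /=; rewrite in_itv /= /center_scale expectation_natRV //=.
Qed.

End law_of_pgf.

(** * Convergence in distribution *)

Section sandwich.
Variables (R : realType) (tau : R).
Hypothesis tau0 : 0 < tau.
Implicit Types (x a e : R).

Local Notation Phi x := (fine (normal_prob 0 tau `]-oo, x]%classic)).

Lemma gint_indic x : gint tau (\1_`]-oo, x]%classic : R -> R).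
Proof.
apply: (gint_le _ _ (gint_cst tau 1)); first exact: measurable_indic.
by move=> y; rewrite indicE; case: (_ \in _); rewrite ?normr1 ?normr0.
Qed.

Lemma gE_indic x : gE tau (\1_`]-oo, x]%classic : R -> R) = Phi x.
Proof.
rewrite /gE /Rintegral /normal_prob [in RHS]integral_mkcond; congr fine.
apply: eq_integral => y _; rewrite patchE indicE.
by case: ifP => _; rewrite ?mul1r ?mul0r.
Qed.

Lemma Phi_dist x e : 0 <= e -> Phi (x + e) <= Phi x + e * normal_peak tau.
Proof.
move=> e0; have p0 : 0 <= normal_peak tau by exact: normal_peak_ge0.
have -> : `]-oo, (x + e)]%classic = `]-oo, x]%classic `|` `]x, (x + e)]%classic :> set R.
  apply/seteqP; split => y /=; rewrite !in_itv /=.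
    by move=> yx; case: (leP y x) => yx'; [left|right].
  by case=> [|/andP[//]]; move=> yx; apply: le_trans yx _; rewrite lerDl.
rewrite measureU //; last first.
  apply/seteqP; split => y //=; rewrite !in_itv /= => -[yx /andP[xy _]].
  by have := lt_le_trans xy yx; rewrite ltxx.
rewrite fineD ?fin_num_measure // lerD2l.
rewrite -[leRHS]/(fine (e * normal_peak tau)%:E) fine_le ?fin_num_measure //.
apply: (@le_trans _ _ (\int[lebesgue_measure]_(y in `]x, (x + e)%R]) (normal_peak tau)%:E)%E).
  apply: ge0_le_integral => //.
  - by move=> y _; rewrite lee_fin normal_pdf_ge0.
  - apply/measurable_funTS/measurable_EFinP; exact: measurable_normal_pdf.
  - by move=> y _; rewrite lee_fin normal_pdf_ub // gt_eqF.
rewrite integral_cst //= lebesgue_measure_itv /= lte_fin.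
case: ifP => _; last by rewrite mule0 lee_fin mulr_ge0.
by rewrite -EFinB -EFinM lee_fin mulrC ler_wpM2r // addrAC subrr add0r.
Qed.

Lemma ramp_Phi_ge a e : 0 < e -> 1 - gauss tau (ramp a e) 0 <= Phi (a + 3 * e).
Proof.
move=> e0; have iu := unit_gint tau 0 (ramp_unit a e).
rewrite lerBlDr -gE_indic -[X in X <= _](gE_cst tau) /gauss -gE_D //; last exact: gint_indic.
apply: gE_le; [exact: gint_cst|by apply: gintD => //; exact: gint_indic|].
move=> y; rewrite add0r indicE; case: (boolP (y \in _)) => yA.
  by rewrite lerDl; have [_ /(_ y)/andP[]] := ramp_unit a e.
rewrite add0r ramp_eq1 //; move: yA; rewrite notin_setE /= in_itv /= => /negP.
by rewrite -ltNge => /ltW.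
Qed.

Lemma ramp_Phi_le a e : 0 < e -> Phi a <= 1 - gauss tau (ramp a e) 0.
Proof.
move=> e0; have iu := unit_gint tau 0 (ramp_unit a e).
rewrite lerBrDr -gE_indic -[X in _ <= X](gE_cst tau) /gauss -gE_D //; last exact: gint_indic.
apply: gE_le; [by apply: gintD => //; exact: gint_indic|exact: gint_cst|].
move=> y; rewrite add0r indicE; case: (boolP (y \in _)) => yA.
  by rewrite ramp_eq0 ?addr0 //; move: yA; rewrite inE /= in_itv.
by rewrite add0r; have [_ /(_ y)/andP[]] := ramp_unit a e.
Qed.

End sandwich.

Section limit.
Variables (R : realType) (m n : nat -> nat).
Hypothesis m_ge2 : forall j, (2 <= m j)%N.
Hypothesis m_oo : m j @[j --> \oo] --> \oo.
Hypothesis n_oo : n j @[j --> \oo] --> \oo.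

Local Notation g j := (galois_pgf R (m j) (n j)).
Local Notation sigma j := (Num.sqrt (var (mahonian R (n j)))).

Let m_gt0 j : (0 < m j)%N. Proof. exact: leq_trans (m_ge2 j). Qed.

Lemma near_natr_ge (k : nat -> nat) (K : R) : k j @[j --> \oo] --> \oo ->
  \forall j \near \oo, K <= (k j)%:R.
Proof.
move=> /cvgnyPge/(_ (Num.bound `|K|)) kK.
near=> j; apply: (@le_trans _ _ (Num.bound `|K|)%:R).
  by apply: le_trans (ler_norm K) (ltW _); apply: archi_boundP.
by rewrite ler_nat; near: j.
Unshelve. all: by end_near. Qed.

Lemma near_divr_le (k : nat -> nat) (K e : R) : 0 < e -> k j @[j --> \oo] --> \oo ->
  \forall j \near \oo, K / (k j)%:R <= e.
Proof.
move=> e0 koo; near=> j.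
have k1 : 1 <= (k j)%:R :> R by near: j; exact: near_natr_ge.
have kK : K / e <= (k j)%:R by near: j; exact: near_natr_ge.
by rewrite ler_pdivrMr ?(lt_le_trans ltr01) // mulrC -ler_pdivrMr.
Unshelve. all: by end_near. Qed.

Lemma cube_le_var l : (2 <= l)%N -> l%:R ^+ 3 <= 72 * var (mahonian R l).
Proof.
move=> l2; have l2R : 2 <= l%:R :> R by rewrite ler_nat.
rewrite var_mahonian; have -> : 72 * (l%:R * (l%:R - 1) * (2 * l%:R + 5) / 72) =
  l%:R * ((l%:R - 1) * (2 * l%:R + 5)) :> R by field.
rewrite exprS; apply: ler_wpM2l => //; nra.
Qed.

Lemma tie_var_ratio l k : (2 <= l)%N -> (0 < k)%N ->
  tie_var R k l <= 72 / k%:R * var (mahonian R l) /\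
  tie_mean_var R k l <= 72 / k%:R * var (mahonian R l).
Proof.
move=> l2 k0; have := cube_le_var l2; have kR : 0 < k%:R^-1 :> R by rewrite invr_gt0 ltr0n.
rewrite -(ler_pM2r kR) => h.
have e : 72 * var (mahonian R l) / k%:R = 72 / k%:R * var (mahonian R l) by ring.
by split; apply: le_trans (_ : l%:R ^+ 3 / k%:R <= _); rewrite ?tie_var_le ?tie_mean_var_le -?e.
Qed.

Section convergence.
Variables (tau : R) (c : nat -> R).
Hypothesis tau0 : 0 < tau.
Hypothesis scale_cvg : forall e, 0 < e -> \forall j \near \oo,
  ((c j)^-1 - tau / sigma j) ^+ 2 * var (g j) <= e.

Lemma near_pexp_ramp a e delta : 0 < e -> 0 < delta -> \forall j \near \oo,
  `|pexp (g j) (fun i => ramp a e ((i%:R - mean (g j)) / c j)) - gauss tau (ramp a e) 0|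
  <= delta.
Proof.
move=> e0 delta0; pose L := 36 / e; pose C := 2 / e ^+ 3.
have L0 : 0 < L by rewrite divr_gt0.
have C0 : 0 < C by rewrite divr_gt0 // exprn_gt0.
pose eta := delta / (4 * L).
have eta0 : 0 < eta by rewrite divr_gt0 // mulr_gt0.
pose kappa := delta * eta / (4 * L).
have kappa0 : 0 < kappa by rewrite divr_gt0 // mulr_gt0.
near=> j.
have n2 : (2 <= n j)%N.
  by rewrite -(ler_nat R); near: j; exact: near_natr_ge.
have v0 : 0 < var (mahonian R (n j)) by exact: var_mahonian_gt0.
have s2 : (sigma j) ^+ 2 = var (mahonian R (n j)) by rewrite sqr_sqrtr // ltW.
have s0 : 0 < sigma j by rewrite sqrtr_gt0.
have : ((c j)^-1 - tau / sigma j) ^+ 2 * var (g j) <= kappa / 4.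
  by near: j; apply: scale_cvg; rewrite divr_gt0.
set u := tau / sigma j => hD.
have hm : (144 * tau ^+ 2) / (m j)%:R <= kappa / 4.
  by near: j; apply: near_divr_le => //; rewrite divr_gt0.
have hn : (32 ^+ 2 * C ^+ 2 * (72 * tau ^+ 2) ^+ 3) / (n j)%:R <= (delta / 2) ^+ 2.
  by near: j; apply: near_divr_le => //; rewrite exprn_gt0 // divr_gt0.
have hT : u ^+ 2 * (tie_var R (m j) (n j) + tie_mean_var R (m j) (n j)) <= kappa / 4.
  have [h1 h2] := tie_var_ratio n2 (m_gt0 j).
  apply: le_trans hm; rewrite /u expr_div_n s2.
  have -> : 144 * tau ^+ 2 / (m j)%:R = tau ^+ 2 / var (mahonian R (n j)) *
      (72 / (m j)%:R * var (mahonian R (n j)) + 72 / (m j)%:R * var (mahonian R (n j))).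
    by field; rewrite pnatr_eq0 -lt0n m_gt0 gt_eqF.
  by rewrite ler_wpM2l ?lerD // divr_ge0 ?sqr_ge0 // ltW.
have := coupling_bound (n j) (m_gt0 j) (c j)^-1 u eta0 (ltW L0)
  (fun x y => ramp_lipschitz a x y e0).
have := mahonian_clt (erefl u) tau0 (ltW C0) n2 (ramp_unit a e) (ramp_taylor a e0).
rewrite (eq_pexp (g j) (_ : _ =1 (fun i => ramp a e ((i%:R - mean (g j)) / c j)))); last first.
  by move=> i; rewrite mulrC.
set A := pexp (g j) _; set B := pexp (mahonian R _) _; set E := gauss _ _ _.
move=> h1 h2.
have {}h1 : `|B - E| <= delta / 2.
  rewrite -(@ler_pXn2r _ 2) ?nnegrE ?divr_ge0 ?(ltW delta0) //.
  apply: le_trans hn; apply: le_trans h1 _.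
  rewrite le_eqVlt; apply/orP; left; apply/eqP; field.
  by rewrite pnatr_eq0 -lt0n (leq_trans _ n2).
have {}h2 : `|A - B| <= delta / 2.
  apply: le_trans h2 _.
  have -> : delta / 2 = L * (eta + kappa / eta).
    by rewrite /kappa /eta; field; rewrite ?gt_eqF.
  rewrite ler_pM2l // lerD2l ler_pM2r ?invr_gt0 //.
  by move: hD hT; rewrite -!(mulrA 2); set p := _ * var (g j); set q := _ * (_ + _) => ? ?; lra.
have -> : A - E = (A - B) + (B - E) by ring.
by apply: le_trans (ler_normD _ _) _; lra.
Unshelve. all: by end_near. Qed.

Lemma near_cdf x delta : 0 < delta -> \forall j \near \oo,
  `|fine (normal_prob 0 tau `]-oo, x]%classic) -
    pexp (g j) (fun i => ((i%:R - mean (g j)) / c j <= x)%R%:R)| <= delta.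
Proof.
move=> delta0; pose e := delta / (6 * (1 + normal_peak tau)).
have p0 : 0 <= normal_peak tau by exact: normal_peak_ge0.
have e0 : 0 < e by rewrite divr_gt0 // mulr_gt0 // ltr_pwDl.
have ep : 3 * e * normal_peak tau <= delta / 2.
  have -> : delta / 2 = 3 * e * (1 + normal_peak tau) by rewrite /e; field; lra.
  by nra.
have d2 : 0 < delta / 2 by rewrite divr_gt0.
near=> j.
have h1 : `|pexp (g j) (fun i => ramp x e ((i%:R - mean (g j)) / c j))
   - gauss tau (ramp x e) 0| <= delta / 2 by near: j; exact: near_pexp_ramp.
have h2 : `|pexp (g j) (fun i => ramp (x - 3 * e) e ((i%:R - mean (g j)) / c j))
   - gauss tau (ramp (x - 3 * e) e) 0| <= delta / 2 by near: j; exact: near_pexp_ramp.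
set F := pexp (g j) (fun i => (_ <= _)%R%:R).
have g0 := galois_nneg R (m j) (n j); have g1 := galois1 R (n j) (m_gt0 j).
have up : F <= 1 - pexp (g j) (fun i => ramp x e ((i%:R - mean (g j)) / c j)).
  apply: (@le_trans _ _ (pexp (g j) (fun=> 1) - pexp (g j) (fun i =>
    ramp x e ((i%:R - mean (g j)) / c j)))); last by rewrite pexp_cst g1 mulr1.
  rewrite lerBrDr -pexpDf; apply: ler_pexp => // i.
  case: (boolP (_ <= x)) => h; first by rewrite ramp_eq0 ?addr0.
  by rewrite add0r; have [_ /(_ ((i%:R - mean (g j)) / c j))/andP[]] := ramp_unit x e.
have lo : 1 - pexp (g j) (fun i => ramp (x - 3 * e) e ((i%:R - mean (g j)) / c j)) <= F.
  apply: (@le_trans _ _ (pexp (g j) (fun=> 1) - pexp (g j) (fun i =>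
    ramp (x - 3 * e) e ((i%:R - mean (g j)) / c j)))); first by rewrite pexp_cst g1 mulr1.
  rewrite lerBlDr -pexpDf; apply: ler_pexp => // i.
  case: (boolP (_ <= x)) => h.
    rewrite lerDl.
    by have [_ /(_ ((i%:R - mean (g j)) / c j))/andP[]] := ramp_unit (x - 3 * e) e.
  by rewrite add0r ramp_eq1 // subrK ltW // ltNge.
have r1 := ramp_Phi_ge tau x e0.
have r2 := ramp_Phi_le tau (x - 3 * e) e0.
have e3 : 0 <= 3 * e by rewrite mulr_ge0 // ltW.
have q1 := Phi_dist tau0 x e3; have q2 := Phi_dist tau0 (x - 3 * e) e3.
rewrite subrK in q2.
move: h1 h2; rewrite !ler_norml => /andP[? ?] /andP[? ?].
apply/andP; split; lra.
Unshelve. all: by end_near. Qed.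

End convergence.

Lemma standard_scale (e : R) : 0 < e -> \forall j \near \oo,
  ((Num.sqrt (var (g j)))^-1 - 1 / sigma j) ^+ 2 * var (g j) <= e.
Proof.
move=> e0; near=> j.
have n2 : (2 <= n j)%N.
  by rewrite -(ler_nat R); near: j; exact: near_natr_ge.
have m1 : 72 / (m j)%:R <= Num.min 1 e.
  by near: j; apply: near_divr_le => //; rewrite lt_min ltr01.
have v0 : 0 < var (mahonian R (n j)) by exact: var_mahonian_gt0.
have vg0 : 0 <= var (g j) by apply: var_ge0; exact: galois_nneg.
have [t1 t2] := tie_var_ratio n2 (m_gt0 j).
have T1 := tie_var_ge0 R (n j) (m_gt0 j); have T2 := tie_mean_var_ge0 R (n j) (m_gt0 j).
have vE := var_galois R (n j) (m_gt0 j).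
set v := var (mahonian R (n j)) in v0 t1 t2 vE *.
set w := var (g j) in vg0 vE *.
pose s := Num.sqrt w; pose r := s / Num.sqrt v.
have r0 : 0 <= r by rewrite divr_ge0 ?sqrtr_ge0.
have r2 : r ^+ 2 = w / v by rewrite /r expr_div_n !sqr_sqrtr // ltW.
have [w0|w0] := eqVneq w 0; first by rewrite w0 mulr0 ltW.
have s0 : s != 0 by rewrite gt_eqF // sqrtr_gt0 lt_neqAle eq_sym w0.
have -> : (s^-1 - 1 / Num.sqrt v) ^+ 2 * w = (1 - r) ^+ 2.
  rewrite -[w in LHS](sqr_sqrtr vg0) -/s /r -exprMn; congr (_ ^+ 2); field.
  by rewrite s0 gt_eqF // sqrtr_gt0.
set q := 72 / (m j)%:R in m1 t1 t2.
have qv : `|1 - r ^+ 2| <= q.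
  rewrite r2; have -> : 1 - w / v = (v - w) / v by field; rewrite gt_eqF.
  rewrite normrM normfV (gtr0_norm v0) ler_pdivrMr // ler_norml.
  by apply/andP; split; lra.
move: m1; rewrite le_min => /andP[q1 qe].
apply: le_trans qe; apply: (@le_trans _ _ (q ^+ 2)); last first.
  have q0 : 0 <= q by apply: le_trans qv.
  by rewrite expr2 ler_piMl.
rewrite -(real_normK (num_real (1 - r))) lerXn2r ?nnegrE ?normr_ge0 //.
  by apply: le_trans qv.
apply: le_trans qv; have -> : 1 - r ^+ 2 = (1 - r) * (1 + r) by ring.
by rewrite normrM ler_peMr // ger0_norm ?addr_ge0 // lerDl.
Unshelve. all: by end_near. Qed.

Lemma power_scale (e tau : R) : 0 < tau -> tau ^+ 2 = 1 / 36 -> 0 < e ->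
  \forall j \near \oo,
  (((n j)%:R `^ (3 / 2))^-1 - tau / sigma j) ^+ 2 * var (g j) <= e.
Proof.
move=> tau0 tau2 e0; near=> j.
have n2 : (2 <= n j)%N.
  by rewrite -(ler_nat R); near: j; exact: near_natr_ge.
have ne : 73 / (n j)%:R <= e by near: j; exact: near_divr_le.
have n2R : 2 <= (n j)%:R :> R by rewrite ler_nat.
have v0 : 0 < var (mahonian R (n j)) by exact: var_mahonian_gt0.
have vg0 : 0 <= var (g j) by apply: var_ge0; exact: galois_nneg.
have T1 := tie_var_ge0 R (n j) (m_gt0 j).
have T2 := tie_mean_var_le R (n j) (m_gt0 j).
have vE := var_galois R (n j) (m_gt0 j).
have h72 := cube_le_var n2.
have wv : var (g j) <= 73 * var (mahonian R (n j)).
  have : (n j)%:R ^+ 3 / (m j)%:R <= (n j)%:R ^+ 3 :> R.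
    by rewrite ler_pdivrMr ?ltr0n // ler_peMr ?exprn_ge0 // ler1n.
  by move=> ?; lra.
set c := _ `^ _.
have c0 : 0 < c by rewrite powR_gt0 // ltr0n (leq_trans _ n2).
have c2 : c ^+ 2 = (n j)%:R ^+ 3.
  rewrite -powR_mulrn ?powR_ge0 // -powRrM -powR_mulrn //.
  by congr (_ `^ _); field.
set s := sigma j; have s0 : 0 < s by rewrite sqrtr_gt0.
have s2 : s ^+ 2 = var (mahonian R (n j)) by rewrite sqr_sqrtr // ltW.
have bound : (s / c - tau) ^+ 2 <= 1 / (n j)%:R.
  have ratio : (s / c) ^+ 2 - tau ^+ 2 = (3 * (n j)%:R - 5) / (72 * (n j)%:R ^+ 2).
    by rewrite expr_div_n s2 c2 var_mahonian tau2; field; rewrite !gt_eqF //; lra.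
  have r0 : 0 < s / c by rewrite divr_gt0.
  set r := s / c in r0 ratio *.
  have rt : 0 <= r ^+ 2 - tau ^+ 2.
    by rewrite ratio divr_ge0 ?mulr_ge0 ?sqr_ge0 //; lra.
  have tr : tau <= r by rewrite -(@ler_pXn2r _ 2) ?nnegrE ?(ltW tau0) ?(ltW r0) // -subr_ge0.
  apply: (@le_trans _ _ (r ^+ 2 - tau ^+ 2)); first by nra.
  rewrite ratio ler_pdivrMr ?mulr_gt0 ?exprn_gt0 //; try lra.
  have -> : 1 / (n j)%:R * (72 * (n j)%:R ^+ 2) = 72 * (n j)%:R :> R by field; lra.
  lra.
apply: le_trans ne.
have -> : (c^-1 - tau / s) ^+ 2 * var (g j) = (s / c - tau) ^+ 2 * (var (g j) / s ^+ 2).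
  by field; rewrite !gt_eqF.
have -> : 73 / (n j)%:R = 1 / (n j)%:R * 73 :> R by ring.
apply: ler_pM => //; [exact: sqr_ge0|by rewrite divr_ge0 ?sqr_ge0|].
by rewrite ler_pdivrMr s2.
Unshelve. all: by end_near. Qed.

End limit.

Lemma cvg_cdf_galois (R : realType) (d : nat -> measure_display)
    (T : forall j, measurableType (d j)) (P : forall j, probability (T j) R)
    (G : forall j, {RV (P j) >-> nat}) (m n : nat -> nat) (tau : R) (c : nat -> R) :
  (forall j, has_pgf (P j) (G j) (galois_pgf R (m j) (n j))) ->
  (forall j, (2 <= m j)%N) ->
  m j @[j --> \oo] --> \oo -> n j @[j --> \oo] --> \oo -> 0 < tau ->
  (forall e, 0 < e -> \forall j \near \oo,
    ((c j)^-1 - tau / Num.sqrt (var (mahonian R (n j)))) ^+ 2 *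
      var (galois_pgf R (m j) (n j)) <= e) ->
  cvg_in_distribution P
    (fun j => center_scale (P j) (natRV (P j) (G j) : {RV (P j) >-> R}) (c j))
    (normal_prob 0 tau).
Proof.
move=> G_pgf m2 m_oo n_oo tau0 scale x _.
have Phi_fin : normal_prob 0 tau `]-oo, x]%classic \is a fin_num.
  exact: (@fin_num_measure _ _ _ (normal_prob 0 tau)).
have lim : (pexp (galois_pgf R (m j) (n j)) (fun k =>
    ((k%:R - mean (galois_pgf R (m j) (n j))) / c j <= x)%R%:R))%:E @[j --> \oo] -->
    (fine (normal_prob 0 tau `]-oo, x]%classic))%:E.
  apply: cvg_EFin; first exact: nearW.
  apply/cvgrPdist_le => delta delta0 /=.
  exact: near_cdf.
rewrite (fineK Phi_fin) in lim.
by under eq_fun do rewrite (cdf_center_scale (G_pgf _)).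
Qed.

Theorem theorem1p4 (R : realType)
    (d : nat -> nat -> measure_display)
    (T : forall n m : nat, measurableType (d n m))
    (P : forall n m : nat, probability (T n m) R)
    (G : forall n m : nat, {RV (P n m) >-> nat})
    (G_pgf : forall n m : nat, (1 <= n)%N -> (2 <= m)%N ->
      has_pgf (P n m) (G n m) ((m%:R ^- n) *: galois R m n))
    (m n : nat -> nat)
    (m_ge2 : forall j, (2 <= m j)%N)
    (n_ge1 : forall j, (1 <= n j)%N)
    (m_oo : m j @[j --> \oo] --> \oo)
    (n_oo : n j @[j --> \oo] --> \oo) :
  let Q := fun j => P (n j) (m j) in
  let X := fun j => natRV (Q j) (G (n j) (m j)) : {RV (Q j) >-> R} in
  cvg_in_distribution Q
    (fun j => center_scale (Q j) (X j) (Num.sqrt (fine 'V_(Q j)[X j])))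
    (normal_prob 0 1)
  /\
  cvg_in_distribution Q
    (fun j => center_scale (Q j) (X j) ((n j)%:R `^ (3 / 2)))
    (normal_prob 0 (Num.sqrt (1 / 36))).
Proof.
move=> Q X.
have pgf j : has_pgf (Q j) (G (n j) (m j)) (galois_pgf R (m j) (n j)).
  exact: G_pgf.
have t0 : 0 < Num.sqrt (1 / 36) :> R by rewrite sqrtr_gt0 divr_gt0.
split.
- apply: (cvg_cdf_galois pgf m_ge2 m_oo n_oo ltr01) => e e0.
  apply: filterS (standard_scale m_ge2 m_oo n_oo e0) => j.
  by rewrite (variance_natRV (pgf j)).
- apply: (cvg_cdf_galois pgf m_ge2 m_oo n_oo t0) => e e0.
  by apply: power_scale => //; rewrite sqr_sqrtr // divr_ge0.
Qed.
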